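(* Let $\epsilon,\delta\in(0,1)$. Suppose there exists a learning algorithm that queries a unitary $U$, distributed according to the Haar measure $\mu_H$ over $U(2^n)$, with $q$ pure states, and outputs a channel $\mathcal{E}$, such that with probability at least $1-\delta$ the channel approximates the Haar-random unitary within average distance $\epsilon$, i.e. $$\Pr_{U\sim\mu_H}\left[d_{\mathrm{avg}}(U(\cdot)U^\dagger,\mathcal{E})\le\epsilon\right]\ge1-\delta .$$ Then the algorithm must make at least $$q\ge2^n(1-\delta)(1-\epsilon)-1$$ queries.
   Context: A query consists of submitting an $n$-qubit pure state $|\psi_{in}\rangle$ (possibly chosen adaptively) and receiving the state $U|\psi_{in}\rangle$. The output $\mathcal{E}$ is an arbitrary CPTP map on $n$-qubit states (not necessarily unitary). The average distance between two channels is $$d_{\mathrm{avg}}(\mathcal{E}_1,\mathcal{E}_2)=1-\mathbf{E}_{|\psi\rangle\sim\mu_S}\left[F(\mathcal{E}_1(|\psi\rangle\langle\psi|),\mathcal{E}_2(|\psi\rangle\langle\psi|))\right],$$ where $\mu_S$ is the Haar (unitarily invariant) probability measure on pure states and $F(\rho,\sigma)=\left(\operatorname{Tr}\sqrt{\sqrt\rho\,\sigma\sqrt\rho}\right)^2$ is the fidelity. *)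

(* Defs.v *)
From HB Require Import structures.
From mathcomp Require Import all_boot all_order all_algebra.
From mathcomp Require Import all_classical all_reals all_analysis.
From mathcomp Require Import measurable_realfun sesquilinear spectral complex.
From mathcomp Require mxtens.

Set Implicit Arguments.
Unset Strict Implicit.
Unset Printing Implicit Defensive.
Import Order.TTheory GRing.Theory Num.Theory.
Local Open Scope classical_set_scope.
Local Open Scope ring_scope.
Local Open Scope sesquilinear_scope.

(* As R[i]^(m x n) is R^(2mn), the sets below generate its Borel sigma-algebra. *)
Definition mx_cylinders (R : realType) (m n : nat) : set (set 'M[R[i]]_(m, n)) :=
  [set A | exists (i : 'I_m) (j : 'I_n) (B : set R), measurable B /\
     (A = (fun M : 'M[R[i]]_(m, n) => complex.Re (M i j)) @^-1` B \/
      A = (fun M : 'M[R[i]]_(m, n) => complex.Im (M i j)) @^-1` B)].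

HB.instance Definition _ (R : realType) := isPointed.Build R[i] 0.
HB.instance Definition _ (R : realType) (m n : nat) :=
  Measurable.copy 'M[R[i]]_(m, n) (g_sigma_algebraType (@mx_cylinders R m n)).

(* The group U(d), with the Borel sigma-algebra inherited from matrices. *)
Definition unitary (R : realType) (d : nat) : Type :=
  {U : 'M[R[i]]_d | U \is unitarymx}.

Definition umx (R : realType) (d : nat) (U : unitary R d) : 'M[R[i]]_d := sval U.
Coercion umx : unitary >-> matrix.

Lemma one_unitary (R : realType) (d : nat) : (1%:M : 'M[R[i]]_d) \is unitarymx.
Proof. by apply/unitarymxP; rewrite trmx1 map_mx1 mulmx1. Qed.

HB.instance Definition _ (R : realType) (d : nat) := gen_eqMixin (unitary R d).
HB.instance Definition _ (R : realType) (d : nat) := gen_choiceMixin (unitary R d).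
HB.instance Definition _ (R : realType) (d : nat) :=
  isPointed.Build (unitary R d) (exist _ 1%:M (@one_unitary R d)).
HB.instance Definition _ (R : realType) (d : nat) :=
  Measurable.copy (unitary R d) (g_sigma_algebra_preimageType (@umx R d)).

Definition umul (R : realType) (d : nat) (U V : unitary R d) : unitary R d :=
  exist _ (umx U *m umx V) (mul_unitarymx (svalP U) (svalP V)).

(* Unit vectors of (C^2)^{(x) n}; a ray is represented by any of its vectors. *)
Definition pure_state (R : realType) (n : nat) : Type :=
  {psi : 'cV[R[i]]_(2 ^ n) | psi ^t* *m psi == 1%:M}.

Definition ket (R : realType) (n : nat) (psi : pure_state R n) :
  'cV[R[i]]_(2 ^ n) := sval psi.

Definition zero_ket (R : realType) (n : nat) : 'cV[R[i]]_(2 ^ n) :=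
  \col_i (val i == 0%N)%:R.

Lemma zero_ket_unit (R : realType) (n : nat) :
  (zero_ket R n) ^t* *m zero_ket R n == 1%:M.
Proof.
have d0 : (0 < 2 ^ n)%N by rewrite expn_gt0.
apply/eqP/matrixP => i j; rewrite !ord1 !mxE (bigD1 (Ordinal d0)) //=.
rewrite !mxE eqxx /= conjC1 mulr1 big1 ?addr0 // => k.
by rewrite -val_eqE /= !mxE => /negbTE ->; rewrite mulr0.
Qed.

HB.instance Definition _ (R : realType) (n : nat) := gen_eqMixin (pure_state R n).
HB.instance Definition _ (R : realType) (n : nat) :=
  gen_choiceMixin (pure_state R n).
HB.instance Definition _ (R : realType) (n : nat) :=
  isPointed.Build (pure_state R n) (exist _ (zero_ket R n) (@zero_ket_unit R n)).
HB.instance Definition _ (R : realType) (n : nat) :=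
  Measurable.copy (pure_state R n) (g_sigma_algebra_preimageType (@ket R n)).

Lemma uapp_unit (R : realType) (n : nat) (U : unitary R (2 ^ n))
    (psi : pure_state R n) :
  (umx U *m ket psi) ^t* *m (umx U *m ket psi) == 1%:M.
Proof.
have UU : (umx U) ^t* *m umx U = 1%:M.
  by apply: mulmx1C; apply/unitarymxP; exact: svalP U.
rewrite trmx_mul map_mxM mulmxA -[_ *m _ *m umx U]mulmxA UU mulmx1.
exact: svalP psi.
Qed.

Definition uapp (R : realType) (n : nat) (U : unitary R (2 ^ n))
    (psi : pure_state R n) : pure_state R n :=
  exist _ (umx U *m ket psi) (uapp_unit U psi).

Definition is_haar_unitary (R : realType) (d : nat)
    (mu : probability (unitary R d) R) : Prop :=
  forall (V : unitary R d) (A : set (unitary R d)), measurable A ->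
    mu [set U | A (umul V U)] = mu A /\ mu [set U | A (umul U V)] = mu A.

Definition is_haar_state (R : realType) (n : nat)
    (mu : probability (pure_state R n) R) : Prop :=
  forall (V : unitary R (2 ^ n)) (A : set (pure_state R n)), measurable A ->
    mu [set psi | A (uapp V psi)] = mu A.

(* The order of R[i] makes 0 <= z mean that z is real and nonnegative. *)
Definition psdmx (R : realType) (d : nat) (A : 'M[R[i]]_d) : Prop :=
  forall v : 'cV[R[i]]_d, 0 <= (v ^t* *m A *m v) 0 0.

(* For A >= 0 this is the unique positive semidefinite square root; its value
   on other matrices is irrelevant. *)
Definition sqrtmx (R : realType) (d : nat) (A : 'M[R[i]]_d) : 'M[R[i]]_d :=
  invmx (spectralmx A) *m diag_mx (map_mx sqrtC (spectral_diag A))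
    *m spectralmx A.

Definition fidelity (R : realType) (d : nat) (rho sigma : 'M[R[i]]_d) : R :=
  complex.Re (\tr (sqrtmx (sqrtmx rho *m sigma *m sqrtmx rho))) ^+ 2.

(* (id_k (x) E) X, where E acts on each of the k x k blocks of X. *)
Definition amplification (R : realType) (d k : nat)
    (E : 'M[R[i]]_d -> 'M[R[i]]_d) (X : 'M[R[i]]_(k * d)) : 'M[R[i]]_(k * d) :=
  \sum_(a < k) \sum_(b < k)
    mxtens.tensmx (delta_mx a b : 'M[R[i]]_k)
      (E (\matrix_(i, j) X (mxtens.mxtens_index (a, i))
                           (mxtens.mxtens_index (b, j)))).

Definition completely_positive (R : realType) (d : nat)
    (E : 'M[R[i]]_d -> 'M[R[i]]_d) : Prop :=
  forall (k : nat) (X : 'M[R[i]]_(k * d)), psdmx X -> psdmx (amplification E X).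

Record channel (R : realType) (d : nat) := Channel {
  channel_map :> {linear 'M[R[i]]_d -> 'M[R[i]]_d};
  channel_tp : forall X : 'M[R[i]]_d, \tr (channel_map X) = \tr X;
  channel_cp : completely_positive channel_map
}.

Definition unitary_map (R : realType) (d : nat) (U : unitary R d)
    (X : 'M[R[i]]_d) : 'M[R[i]]_d := umx U *m X *m (umx U) ^t*.

Definition density (R : realType) (n : nat) (psi : pure_state R n) :
  'M[R[i]]_(2 ^ n) := ket psi *m (ket psi) ^t*.

Definition d_avg (R : realType) (n : nat) (muS : probability (pure_state R n) R)
    (E1 E2 : 'M[R[i]]_(2 ^ n) -> 'M[R[i]]_(2 ^ n)) : R :=
  1 - \int[muS]_psi fidelity (E1 (density psi)) (E2 (density psi)).

Definition sqnorm (R : realType) (m : nat) (v : 'cV[R[i]]_m) : R :=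
  complex.Re ((v ^t* *m v) 0 0).

(* learner R n m q: the rest of an adaptive quantum protocol whose quantum
   memory is C^m and which may still make at most q queries.
   - Output E stops and returns the channel E.
   - Query psi next prepares psi, submits it, receives U|psi> and appends it to
     the memory, which becomes C^m (x) C^(2^n).
   - Measure nu K next applies to the memory the quantum instrument with Kraus
     operators K t : C^m -> C^m' (densities with respect to the reference
     measure nu on the outcomes), and continues according to the outcome t.
     With a one-point outcome space this is an isometry (e.g. a unitary gate or
     the adjunction of ancillas); with scalar K it is classical randomness. In
     finite dimension every instrument with values in a standard Borel space is
     of this form, up to recording a finer outcome. *)
Inductive learner (R : realType) (n : nat) : nat -> nat -> Type :=
| Output (m q : nat) (E : channel R (2 ^ n)) : learner R n m q
| Query (m q : nat) (psi : pure_state R n) (next : learner R n (m * 2 ^ n) q) :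
    learner R n m q.+1
| Measure (m m' q : nat) (disp : measure_display) (T : measurableType disp)
    (nu : {sigma_finite_measure set T -> \bar R}) (K : T -> 'M[R[i]]_(m', m))
    (next : T -> learner R n m' q) : learner R n m q.

(* Born rule: probability that the returned channel is within average distance eps of U.
   The memory vector v is not normalized: its squared norm is the probability
   (density) of the outcomes observed so far. *)
Fixpoint success (R : realType) (n : nat) (muS : probability (pure_state R n) R)
    (eps : R) (U : unitary R (2 ^ n)) (m q : nat) (L : learner R n m q) :
    'cV[R[i]]_m -> \bar R :=
  match L in learner _ _ m0 _ return 'cV[R[i]]_m0 -> \bar R with
  | Output m0 _ E => fun v =>
      if d_avg muS (unitary_map U) E <= eps then (sqnorm v)%:E else 0%E
  | Query m0 _ psi next => fun v =>
      success muS eps U next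
        (mxtens.tensmx v (ket (uapp U psi)) : 'cV[R[i]]_(m0 * 2 ^ n))
  | Measure _ _ _ _ _ nu K next => fun v =>
      (\int[nu]_t success muS eps U (next t) (K t *m v))%E
  end.

(* Every instrument is trace preserving (the integral of K^* K is the identity,
   tested on vectors) and everything depends measurably on the outcomes, so that
   the integrals in success are genuine probabilities. *)
Fixpoint valid_learner (R : realType) (n : nat)
    (muS : probability (pure_state R n) R) (m q : nat) (L : learner R n m q) :
    Prop :=
  match L with
  | Output _ _ _ => True
  | Query _ _ _ next => valid_learner muS next
  | Measure m0 m' _ _ T nu K next =>
      [/\ measurable_fun setT K,
          forall v : 'cV[R[i]]_m0,
            (\int[nu]_t (sqnorm (K t *m v))%:E = (sqnorm v)%:E)%E,
          forall eps : R, measurable_fun setT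
            (fun x : T * ('cV[R[i]]_m' * unitary R (2 ^ n)) =>
               success muS eps x.2.2 (next x.1) x.2.1)
        & forall t : T, valid_learner muS (next t)]
  end.

(* The learner starts with the trivial memory C^1. *)
Definition success_prob (R : realType) (n q : nat)
    (muH : probability (unitary R (2 ^ n)) R)
    (muS : probability (pure_state R n) R) (eps : R) (L : learner R n 1 q) :
    \bar R :=
  (\int[muH]_U success muS eps U L 1%:M)%E.

(* Main.v *)
(* After the queries psi_1, .., psi_k (k <= q) the memory of the learner depends
   on U only through U psi_1, .., U psi_k, so it does not change when U is
   replaced by U W for a unitary W fixing every psi_a, while Haar measure is
   invariant under U -> U W. Hence the average fidelity of the returned channel E
   may be averaged over a finite set of such W: all signed permutations of a
   basis if q = 0, and otherwise the diagonal signs acting trivially on the first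
   q vectors of a basis, those vectors spanning a space that contains the psi_a.
   The second moments of a Haar random state give, with d = 2 ^ n and for any
   orthonormal basis (x_i), average fidelity
     (d + \sum_(i, j) <U x_i | E(|x_i><x_j|) | U x_j>) / (d (d + 1)),
   and complete positivity bounds the average over W of the double sum by d q (by
   1 if q = 0), so that the averaged fidelity is at most (q + 1) / d. By Markov's
   inequality the success probability is at most (q + 1) / (d (1 - eps)). *)
Require Import Defs.
From mathcomp Require Import all_boot all_order all_algebra.
From mathcomp Require Import all_classical all_reals all_analysis.
From mathcomp Require Import fingroup perm.
From mathcomp Require Import measurable_realfun sesquilinear spectral complex.
From mathcomp Require mxtens.
From mathcomp Require Import ring lra zify.

Set Implicit Arguments.
Unset Strict Implicit.
Unset Printing Implicit Defensive.
Import Order.TTheory GRing.Theory Num.Theory.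
Local Open Scope classical_set_scope.
Local Open Scope ring_scope.
Local Open Scope sesquilinear_scope.

Local Notation conjC := Num.conj.

(** * Complex numbers and quadratic forms *)

Section ComplexParts.
Variable R : realType.
Implicit Types x y : R[i].

Lemma conjCE x : conjC x = (complex.Re x -i* complex.Im x)%C.
Proof. by case: x. Qed.

Lemma Re_add x y : complex.Re (x + y) = complex.Re x + complex.Re y.
Proof. by case: x; case: y. Qed.

Lemma Im_add x y : complex.Im (x + y) = complex.Im x + complex.Im y.
Proof. by case: x; case: y. Qed.

Lemma Re_mul x y : complex.Re (x * y) =
  complex.Re x * complex.Re y - complex.Im x * complex.Im y.
Proof. by case: x; case: y. Qed.

Lemma Im_mul x y : complex.Im (x * y) =
  complex.Re x * complex.Im y + complex.Im x * complex.Re y.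
Proof. by case: x; case: y => /= *. Qed.

Lemma Re_conj x : complex.Re (conjC x) = complex.Re x.
Proof. by case: x. Qed.

Lemma Im_conj x : complex.Im (conjC x) = - complex.Im x.
Proof. by case: x. Qed.

Lemma Re_sum (I : Type) (r : seq I) (P : pred I) (F : I -> R[i]) :
  complex.Re (\sum_(i <- r | P i) F i) = \sum_(i <- r | P i) complex.Re (F i).
Proof. exact: (big_morph _ Re_add (erefl _)). Qed.

Lemma ge0_ReE x : 0 <= x -> x = (complex.Re x)%:C%C.
Proof. by move=> x0; rewrite RRe_real // ger0_real. Qed.

Lemma Re_ge0 x : 0 <= x -> 0 <= complex.Re x.
Proof. by case: x => a b; rewrite lecE /= => /andP[]. Qed.

Lemma normc_sqrE x : conjC x * x = (complex.Re x ^+ 2 + complex.Im x ^+ 2)%:C%C.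
Proof.
rewrite conjCE; case: x => a b; apply/eqP; rewrite eq_complex /=.
by apply/andP; split; apply/eqP; ring.
Qed.

End ComplexParts.

Section MatrixForms.
Variables (R : realType) (d : nat).
Implicit Types (A : 'M[R[i]]_d) (v : 'cV[R[i]]_d).

Lemma adjmxM (m n p : nat) (A : 'M[R[i]]_(m, n)) (B : 'M[R[i]]_(n, p)) :
  (A *m B)^t* = B^t* *m A^t*.
Proof. by rewrite trmx_mul map_mxM. Qed.

(** Every eigenvalue of [A] is 0 or [f], and on these two values the square root agrees with
    division by [Num.sqrt f]. For [f = 0] the convention that the inverse of 0 is 0 makes both sides
    vanish. *)
Lemma sqrtmx_scaled_proj A (f : R) : 0 <= f -> A \is normalmx ->
  A *m A = f%:C%C *: A -> sqrtmx A = (Num.sqrt f)^-1%:C%C *: A.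
Proof.
move=> f0 nA; move/orthomx_spectralP: (nA) => defA AA.
set P := spectralmx A in defA *; set D := spectral_diag A in defA *.
have uP : P \in unitmx by exact: spectral_unit.
have DD : forall i, D 0 i * D 0 i = f%:C%C * D 0 i.
  move=> i; move: AA; rewrite {1 2 3}defA => /(congr1 (fun X => P *m X *m invmx P)).
  rewrite -scalemxAr -scalemxAl !mulmxA mulmxV // mul1mx !mulmxK //.
  by rewrite mulmx_diag => /matrixP/(_ i i); rewrite !mxE eqxx !mulr1n.
rewrite /sqrtmx -/P -/D [in RHS]defA scalemxAl scalemxAr; congr (_ *m _ *m _).
apply/matrixP => i j; rewrite !mxE; case: eqP => [->|_]; rewrite ?mulr1n ?mulr0n ?mulr0 //.
have /eqP := DD j; rewrite -subr_eq0 -mulrBl mulf_eq0 subr_eq0.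
case/orP=> /eqP ->; last by rewrite sqrtC0 mulr0.
have [->|fN0] := eqVneq f 0; first by rewrite sqrtC0 mulr0.
have sf : sqrtC f%:C%C = (Num.sqrt f)%:C%C :> R[i].
  rewrite -[X in sqrtC X%:C%C](sqr_sqrtr f0) rmorphXn /= sqrCK //.
  by rewrite ler0c sqrtr_ge0.
rewrite sf -rmorphM /=; congr (_%:C%C).
have s0 : Num.sqrt f != 0 by rewrite sqrtr_eq0 -ltNge lt_def fN0.
by apply: (mulfI s0); rewrite mulrA divff // mul1r -expr2 sqr_sqrtr.
Qed.

Lemma normalmx_herm A : A^t* = A -> A \is normalmx.
Proof. by move=> hA; apply/normalmxP; rewrite hA. Qed.

Lemma dot_real v : (v^t* *m v) 0 0 = (sqnorm v)%:C%C.
Proof.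
rewrite /sqnorm -ge0_ReE // !mxE; apply: sumr_ge0 => k _.
by rewrite !mxE normc_sqrE ler0c addr_ge0 ?sqr_ge0.
Qed.

Lemma sqnorm_ge0 v : 0 <= sqnorm v.
Proof.
rewrite /sqnorm !mxE; apply: Re_ge0; apply: sumr_ge0 => k _.
by rewrite !mxE normc_sqrE ler0c addr_ge0 ?sqr_ge0.
Qed.

End MatrixForms.

(** * Fidelity of pure states *)

Lemma sum_mxtens (V : nmodType) (m n : nat) (F : 'I_(m * n) -> V) :
  \sum_k F k = \sum_a \sum_i F (mxtens.mxtens_index (a, i)).
Proof.
rewrite pair_big (reindex (@mxtens.mxtens_index m n)) /=; last first.
  by exists (@mxtens.mxtens_unindex m n) => k _;
    rewrite (mxtens.mxtens_indexK, mxtens.mxtens_unindexK).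
by apply: eq_bigr => -[].
Qed.

Section PureFidelity.
Variables (R : realType) (d : nat).

Lemma formE (u v : 'cV[R[i]]_d) (A : 'M[R[i]]_d) :
  (u^t* *m A *m v) 0 0 = \sum_i \sum_j conjC (u i 0) * A i j * v j 0.
Proof.
rewrite mxE; under eq_bigr do rewrite mxE mulr_suml.
rewrite exchange_big; apply: eq_bigr => i _; apply: eq_bigr => j _.
by rewrite !mxE.
Qed.

Lemma psdmx_rank1 (u : 'cV[R[i]]_d) : psdmx (u *m u^t*).
Proof.
move=> v; rewrite mulmxA -mulmxA.
have -> : v^t* *m u = (u^t* *m v)^t* by rewrite adjmxM trmxCK.
rewrite mxE big_ord1 !mxE normc_sqrE ler0c.
by rewrite addr_ge0 ?sqr_ge0.
Qed.

(** The projector [rho] is its own square root, and [rho *m sigma *m rho] is [rho] multiplied by f =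
    <phi|sigma|phi>, which is nonnegative because [sigma] is positive. The square root of this
    product has trace sqrt f. *)
Lemma fidelity_pure (phi : 'cV[R[i]]_d) (sigma : 'M[R[i]]_d) :
  phi^t* *m phi = 1%:M -> psdmx sigma ->
  fidelity (phi *m phi^t*) sigma = complex.Re ((phi^t* *m sigma *m phi) 0 0).
Proof.
move=> phi1 s0; set rho := phi *m phi^t*.
have rhoH : rho^t* = rho by rewrite adjmxM trmxCK.
have rho2 : rho *m rho = rho.
  by rewrite /rho mulmxA -[_ *m _ *m phi]mulmxA phi1 mulmx1.
rewrite /fidelity.
have -> : sqrtmx rho = rho.
  rewrite (@sqrtmx_scaled_proj _ _ _ 1) ?ler01 ?normalmx_herm //.
    by rewrite sqrtr1 invr1 scale1r.
  by rewrite scale1r.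
set f := complex.Re ((_ *m phi) 0 0).
have zE : (phi^t* *m sigma *m phi) 0 0 = f%:C%C by exact: ge0_ReE.
have f0 : 0 <= f by exact: Re_ge0.
have defB : rho *m sigma *m rho = f%:C%C *: rho.
  have -> : rho *m sigma *m rho = phi *m (phi^t* *m sigma *m phi) *m phi^t*.
    by rewrite /rho !mulmxA.
  by rewrite [_ *m sigma *m phi]mx11_scalar zE mul_mx_scalar -scalemxAl.
rewrite defB (@sqrtmx_scaled_proj _ _ _ f) //; last 2 first.
- apply: normalmx_herm; rewrite linearZ /= map_mxZ rhoH; congr (_ *: _).
  by apply/eqP; rewrite eq_complex /= oppr0 !eqxx.
- by rewrite -scalemxAl -scalemxAr rho2.
rewrite !linearZ /= mxtrace_mulC phi1 mxtrace1 mulr1 -rmorphM /=.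
have [->|fN0] := eqVneq f 0; first by rewrite mulr0 expr0n.
by rewrite exprMn exprVn sqr_sqrtr // expr2 mulKf.
Qed.

End PureFidelity.

(** Stack the vectors [x a] into one vector of C^k (x) C^d. Its rank-one projector has blocks x_a
    x_b^*, so complete positivity, tested on the stacked [y a], gives this sum. *)
Lemma cp_sum (R : realType) (d : nat) (E : {linear 'M[R[i]]_d -> 'M[R[i]]_d})
    (k : nat) (x y : 'I_k -> 'cV[R[i]]_d) : completely_positive E ->
  0 <= \sum_a \sum_b ((y a)^t* *m E (x a *m (x b)^t*) *m y b) 0 0.
Proof.
move=> cpE.
pose st (z : 'I_k -> 'cV[R[i]]_d) : 'cV[R[i]]_(k * d) :=
  \col_s z (mxtens.mxtens_unindex s).1 (mxtens.mxtens_unindex s).2 0.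
have stE z a i : st z (mxtens.mxtens_index (a, i)) 0 = z a i 0.
  by rewrite mxE mxtens.mxtens_indexK.
have := cpE k (st x *m (st x)^t*) (psdmx_rank1 (st x)) (st y).
congr (0 <= _); rewrite formE sum_mxtens; apply: eq_bigr => a _.
under eq_bigr do rewrite sum_mxtens.
rewrite exchange_big; apply: eq_bigr => b _; rewrite formE.
apply: eq_bigr => i _; apply: eq_bigr => j _; rewrite !stE; congr (_ * _ * _).
rewrite /amplification summxE (bigD1 a) //= summxE (bigD1 b) //=.
rewrite mxtens.tensmxE !mxE !eqxx mul1r big1 ?addr0; last first.
  by move=> b' /negbTE nb; rewrite mxtens.tensmxE !mxE (eq_sym b) nb andbF mul0r.
rewrite big1 ?addr0; last first.
  move=> a' /negbTE na; rewrite summxE big1 // => b' _.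
  by rewrite mxtens.tensmxE !mxE (eq_sym a) na mul0r.
congr (E _ _ _); apply/matrixP => i' j'; rewrite !mxE !big_ord1 !mxE.
by rewrite !mxtens.mxtens_indexK.
Qed.

(** * Measurability and integrals of complex functions *)

Section ComplexMeasurable.
Context (R : realType) (disp : measure_display) (T : measurableType disp).
Implicit Types f g : T -> R[i].

Definition cmeas f := measurable_fun setT (fun x => complex.Re (f x)) /\
  measurable_fun setT (fun x => complex.Im (f x)).

Lemma cmeas_cst (c : R[i]) : cmeas (fun=> c).
Proof. by split; exact: measurable_cst. Qed.

Lemma cmeasD f g : cmeas f -> cmeas g -> cmeas (fun x => f x + g x).
Proof.
move=> [f1 f2] [g1 g2]; split; [under eq_fun do rewrite Re_add | under eq_fun do rewrite Im_add];
  exact: measurable_funD.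
Qed.

Lemma cmeasM f g : cmeas f -> cmeas g -> cmeas (fun x => f x * g x).
Proof.
move=> [f1 f2] [g1 g2]; split; [under eq_fun do rewrite Re_mul | under eq_fun do rewrite Im_mul].
- by apply: measurable_funB; apply: measurable_funM.
- by apply: measurable_funD; apply: measurable_funM.
Qed.

Lemma cmeasJ f : cmeas f -> cmeas (fun x => conjC (f x)).
Proof.
move=> [f1 f2]; split; [under eq_fun do rewrite Re_conj | under eq_fun do rewrite Im_conj] => //.
exact: measurableT_comp.
Qed.

Lemma cmeas_sum (I : Type) (r : seq I) (F : I -> T -> R[i]) :
  (forall i, cmeas (F i)) -> cmeas (fun x => \sum_(i <- r) F i x).
Proof.
move=> mF; elim: r => [|i r IH].
  by under eq_fun do rewrite big_nil; exact: cmeas_cst.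
by under eq_fun do rewrite big_cons; exact: cmeasD.
Qed.

Lemma measurable_mxP (m n : nat) (F : T -> 'M[R[i]]_(m, n)) :
  measurable_fun setT F <-> forall i j, cmeas (fun x => F x i j).
Proof.
split=> [mF i j|mF].
  have mc (c : R[i] -> R) : (c = @complex.Re R \/ c = @complex.Im R) ->
      measurable_fun setT (fun M : 'M[R[i]]_(m, n) => c (M i j)).
    move=> hc _ B mB; rewrite setTI; apply: sub_sigma_algebra.
    by exists i, j, B; split => //; case: hc => ->; [left | right].
  by split; [apply: (measurableT_comp (mc _ (or_introl erefl)) mF)
    | apply: (measurableT_comp (mc _ (or_intror erefl)) mF)].
apply: (@measurability _ _ _ _ _ _ (@mx_cylinders R m n)) => //.
move=> _ [_ [i [j [B [mB [->|->]]]]] <-].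
- exact: (mF i j).1.
- exact: (mF i j).2.
Qed.

Lemma measurable_umxP (d : nat) (F : T -> unitary R d) :
  measurable_fun setT F <-> measurable_fun setT (fun x => umx (F x)).
Proof.
split=> mF; last first.
  move=> _ A [B mB <-]; rewrite setTI setTI.
  by have := mF measurableT B mB; rewrite setTI.
move=> _ B mB; rewrite setTI.
have := mF measurableT (@umx R d @^-1` B); rewrite setTI; apply.
by exists B => //; rewrite setTI.
Qed.

Lemma measurable_ketP (n : nat) (F : T -> pure_state R n) :
  measurable_fun setT F <-> measurable_fun setT (fun x => ket (F x)).
Proof.
split=> mF; last first.
  move=> _ A [B mB <-]; rewrite setTI setTI.
  by have := mF measurableT B mB; rewrite setTI.
move=> _ B mB; rewrite setTI.
have := mF measurableT (@ket R n @^-1` B); rewrite setTI; apply.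
by exists B => //; rewrite setTI.
Qed.

Lemma measurable_mulmx (m n p : nat) (F : T -> 'M[R[i]]_(m, n))
    (G : T -> 'M[R[i]]_(n, p)) :
  measurable_fun setT F -> measurable_fun setT G ->
  measurable_fun setT (fun x => F x *m G x).
Proof.
move=> /measurable_mxP mF /measurable_mxP mG; apply/measurable_mxP => i j.
by under eq_fun do rewrite mxE; apply: cmeas_sum => k; exact: cmeasM.
Qed.

Lemma measurable_adjmx (m n : nat) (F : T -> 'M[R[i]]_(m, n)) :
  measurable_fun setT F -> measurable_fun setT (fun x => (F x)^t*).
Proof.
move=> /measurable_mxP mF; apply/measurable_mxP => i j.
by under eq_fun do rewrite !mxE; exact: cmeasJ.
Qed.

Lemma measurable_tensmx (m n p q : nat) (F : T -> 'M[R[i]]_(m, n))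
    (G : T -> 'M[R[i]]_(p, q)) :
  measurable_fun setT F -> measurable_fun setT G ->
  measurable_fun setT (fun x => mxtens.tensmx (F x) (G x)).
Proof.
move=> /measurable_mxP mF /measurable_mxP mG; apply/measurable_mxP => i j.
by under eq_fun do rewrite !mxE; exact: cmeasM.
Qed.

Lemma measurable_sqnorm (m : nat) (F : T -> 'cV[R[i]]_m) :
  measurable_fun setT F -> measurable_fun setT (fun x => sqnorm (F x)).
Proof.
move=> mF; have /measurable_mxP/(_ 0 0) [] // :
  measurable_fun setT (fun x => (F x)^t* *m F x).
by apply: measurable_mulmx => //; exact: measurable_adjmx.
Qed.

End ComplexMeasurable.

Section Coordinates.
Variable R : realType.

Lemma measurable_umx (d : nat) : measurable_fun setT (@umx R d).
Proof. by apply/measurable_umxP; exact: measurable_id. Qed.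

Lemma measurable_ket (n : nat) : measurable_fun setT (@ket R n).
Proof. by apply/measurable_ketP; exact: measurable_id. Qed.

End Coordinates.

Section ComplexIntegral.
Context (R : realType) (disp : measure_display) (T : measurableType disp).
Variable mu : probability T R.
Implicit Types f g : T -> R[i].

(** Working by parts reduces complex linearity to facts about real integrals. *)
Definition cint f : R[i] := (\int[mu]_x complex.Re (f x) +i* \int[mu]_x complex.Im (f x))%C.

Definition cbounded f := exists M : R[i], forall x, `|f x| <= M.

Lemma cbounded_cst (c : R[i]) : cbounded (fun=> c).
Proof. by exists `|c|. Qed.

Lemma cboundedD f g : cbounded f -> cbounded g -> cbounded (fun x => f x + g x).
Proof.
move=> [M Mf] [N Ng]; exists (M + N) => x.
by rewrite (le_trans (ler_normD _ _)) // lerD.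
Qed.

Lemma cboundedM f g : cbounded f -> cbounded g -> cbounded (fun x => f x * g x).
Proof. by move=> [M Mf] [N Ng]; exists (M * N) => x; rewrite normrM ler_pM. Qed.

Lemma cboundedJ f : cbounded f -> cbounded (fun x => conjC (f x)).
Proof. by move=> [M Mf]; exists M => x; rewrite norm_conjC. Qed.

Lemma cbounded_sum (I : Type) (r : seq I) (F : I -> T -> R[i]) :
  (forall i, cbounded (F i)) -> cbounded (fun x => \sum_(i <- r) F i x).
Proof.
move=> bF; elim: r => [|i r IH].
  by under eq_fun do rewrite big_nil; exact: cbounded_cst.
by under eq_fun do rewrite big_cons; exact: cboundedD.
Qed.

(** On a probability space this implies integrability. Unlike integrability it is stable under
    products, so every polynomial in the amplitudes and their conjugates qualifies. *)
Definition cint_ok f := cmeas f /\ cbounded f.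

Lemma cint_okM f g : cint_ok f -> cint_ok g -> cint_ok (fun x => f x * g x).
Proof. by move=> [? ?] [? ?]; split; [exact: cmeasM | exact: cboundedM]. Qed.

Lemma cint_okJ f : cint_ok f -> cint_ok (fun x => conjC (f x)).
Proof. by move=> [? ?]; split; [exact: cmeasJ | exact: cboundedJ]. Qed.

Lemma cint_ok_cst (c : R[i]) : cint_ok (fun=> c).
Proof. by split; [exact: cmeas_cst | exact: cbounded_cst]. Qed.

Lemma cint_ok_sum (I : Type) (r : seq I) (F : I -> T -> R[i]) :
  (forall i, cint_ok (F i)) -> cint_ok (fun x => \sum_(i <- r) F i x).
Proof.
by move=> h; split; [apply: cmeas_sum | apply: cbounded_sum] => i; case: (h i).
Qed.

Lemma Re_Im_le_norm (z : R[i]) :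
  `|complex.Re z| <= complex.Re `|z| /\ `|complex.Im z| <= complex.Re `|z|.
Proof.
rewrite normc_def /= -!sqrtr_sqr; split; apply/ler_wsqrtr.
- by rewrite lerDl sqr_ge0.
- by rewrite lerDr sqr_ge0.
Qed.

Lemma cint_integrable f : cint_ok f ->
  mu.-integrable setT (EFin \o (fun x => complex.Re (f x))) /\
  mu.-integrable setT (EFin \o (fun x => complex.Im (f x))).
Proof.
move=> [[m1 m2] [M bf]].
have bR x : complex.Re `|f x| <= complex.Re M.
  by have := bf x; rewrite lecE => /andP[].
have muT : (mu setT < +oo)%E by rewrite probability_setT ltry.
have bd (h : T -> R) : (forall x, `|h x| <= complex.Re `|f x|) -> [bounded h x | x in setT].
  move=> hh; exists (complex.Re M); split=> [|N MN x _ /=]; first exact: num_real.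
  exact: (ltW (le_lt_trans (le_trans (hh x) (bR x)) MN)).
by split; apply: measurable_bounded_integrable => //; apply: bd => x;
  have [] := Re_Im_le_norm (f x).
Qed.

Lemma cintD f g : cint_ok f -> cint_ok g ->
  cint (fun x => f x + g x) = cint f + cint g.
Proof.
move=> /cint_integrable[f1 f2] /cint_integrable[g1 g2]; rewrite /cint.
by congr Complex; rewrite -RintegralD //; apply: eq_Rintegral => x _;
  rewrite (Re_add, Im_add).
Qed.

Lemma cintZ (c : R[i]) f : cint_ok f -> cint (fun x => c * f x) = c * cint f.
Proof.
move=> okf; have [f1 f2] := cint_integrable okf; case: c => a b; rewrite /cint /=.
have eZ (r : R) (h : T -> R) : mu.-integrable setT (EFin \o h) ->
    mu.-integrable setT (EFin \o (fun x => r * h x)).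
  move=> ih; rewrite (_ : _ \o _ = (fun x => r%:E * (EFin \o h) x)%E) //.
  exact: integrableZl.
congr Complex.
- under eq_Rintegral do rewrite Re_mul /= -mulNr.
  by rewrite RintegralD ?RintegralZl ?mulNr //; exact: eZ.
- under eq_Rintegral do rewrite Im_mul /=.
  by rewrite RintegralD ?RintegralZl //; exact: eZ.
Qed.

Lemma cint0 : cint (fun=> 0) = 0.
Proof. by rewrite /cint /= !Rintegral_cst // !mul0r. Qed.

Lemma cint_sum (I : Type) (r : seq I) (F : I -> T -> R[i]) :
  (forall i, cint_ok (F i)) ->
  cint (fun x => \sum_(i <- r) F i x) = \sum_(i <- r) cint (F i).
Proof.
move=> okF; elim: r => [|i r IH].
  by under eq_fun do rewrite big_nil; rewrite big_nil cint0.
under eq_fun do rewrite big_cons.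
by rewrite big_cons cintD ?IH //; exact: cint_ok_sum.
Qed.

End ComplexIntegral.

(** * Complex reflections *)

Section RankOneUnitary.
Variables (R : realType) (d : nat).

Lemma adjmxBZ (m n : nat) (A B : 'M[R[i]]_(m, n)) (c : R[i]) :
  (A - c *: B)^t* = A^t* - conjC c *: B^t*.
Proof. by apply/matrixP => i j; rewrite !mxE rmorphB rmorphM. Qed.

(* A complex reflection, with the vector u left unnormalized to avoid square roots. *)
Lemma reflection_unitary (u : 'cV[R[i]]_d) (s c : R[i]) :
  u^t* *m u = s%:M -> c + conjC c = s * (c * conjC c) ->
  1%:M - c *: (u *m u^t*) \is unitarymx.
Proof.
move=> uu cc; apply/unitarymxP; set P := u *m u^t*.
have PH : P^t* = P by rewrite adjmxM trmxCK.
have P2 : P *m P = s *: P.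
  by rewrite /P mulmxA -[_ *m _ *m u]mulmxA uu mul_mx_scalar -scalemxAl.
have -> : (1%:M - c *: P)^t* = 1%:M - conjC c *: P.
  by rewrite adjmxBZ trmx1 map_mx1 PH.
rewrite mulmxBl mul1mx mulmxBr mulmx1 -scalemxAl -scalemxAr P2 !scalerA.
have -> : c * conjC c * s = c + conjC c by rewrite cc mulrC.
by rewrite scalerDl opprB (addrC (c *: P)) addrK subrK.
Qed.

End RankOneUnitary.

Definition unitary_of (R : realType) (d : nat) (M : 'M[R[i]]_d)
  (uM : M \is unitarymx) : unitary R d := exist _ M uM.

(** * Second moments of Haar random states *)

Section HaarMoments.
Variables (R : realType) (n : nat) (mu : probability (pure_state R n) R).
Hypothesis haar_mu : is_haar_state mu.
Local Notation d := (2 ^ n)%N.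
Implicit Types (i j k l : 'I_d) (psi : pure_state R n).

Local Notation amp psi i := (ket psi i 0).

Lemma measurable_uapp (V : unitary R d) : measurable_fun setT (uapp V).
Proof.
apply/measurable_ketP; apply: (measurable_mulmx (F := fun=> umx V)).
- exact: measurable_cst.
- exact: measurable_ket.
Qed.

Lemma haar_state_integral (V : unitary R d) (f : pure_state R n -> R) :
  measurable_fun setT f -> mu.-integrable setT (EFin \o (f \o uapp V)) ->
  \int[mu]_psi f (uapp V psi) = \int[mu]_psi f psi.
Proof.
move=> mf intf; congr fine; have mV := measurable_uapp V.
rewrite -[RHS](@eq_measure_integral _ _ _ _ _ (pushforward mu (uapp V))).
- rewrite integral_pushforward //; first exact/measurable_EFinP.
- by move=> A mA _; exact: (haar_mu V mA).
Qed.

Lemma cint_ok_uapp (V : unitary R d) (f : pure_state R n -> R[i]) :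
  cint_ok f -> cint_ok (fun psi => f (uapp V psi)).
Proof.
move=> [[m1 m2] [M bf]]; have mV := measurable_uapp V; split; last by exists M => psi.
by split; [exact: (measurableT_comp m1 mV) | exact: (measurableT_comp m2 mV)].
Qed.

Lemma cint_haar (V : unitary R d) (f : pure_state R n -> R[i]) :
  cint_ok f -> cint mu (fun psi => f (uapp V psi)) = cint mu f.
Proof.
move=> okf; have [i1 i2] := cint_integrable mu (cint_ok_uapp V okf).
case: okf => -[m1 m2] _; congr Complex.
- exact: (haar_state_integral (f := fun psi => complex.Re (f psi))).
- exact: (haar_state_integral (f := fun psi => complex.Im (f psi))).
Qed.

Definition prob psi i : R := complex.Re (amp psi i) ^+ 2 + complex.Im (amp psi i) ^+ 2.

Lemma sum_prob psi : \sum_i prob psi i = 1.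
Proof.
have /eqP := svalP psi; rewrite -/(ket psi) => /matrixP /(_ 0 0); rewrite !mxE eqxx.
move=> e1; rewrite -[RHS]/(complex.Re (1 : R[i])) -[1 in RHS]e1 Re_sum.
by apply: eq_bigr => i _; rewrite !mxE normc_sqrE.
Qed.

Lemma prob_le1 psi i : 0 <= prob psi i <= 1.
Proof.
rewrite addr_ge0 ?sqr_ge0 //= -(sum_prob psi) (bigD1 i) //= lerDl.
by apply: sumr_ge0 => k _; rewrite addr_ge0 ?sqr_ge0.
Qed.

Lemma amp_ok i : cint_ok (fun psi => amp psi i).
Proof.
split; first by apply: ((measurable_mxP (@ket R n)).1 (@measurable_ket R n)).
exists 1 => psi; rewrite -(@expr_le1 _ 2) // -add_Re2_Im2 (lecR _ 1).
by case/andP: (prob_le1 psi i).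
Qed.

(** The indices are ordered as in the expansion of the overlap: [i] and [j] come from the two copies
    of U psi on the output side, [k] and [l] from |psi><psi| on the input side. *)
Definition moment i j k l := cint mu (fun psi =>
  conjC (amp psi i) * amp psi j * amp psi k * conjC (amp psi l)).

Lemma moment_ok i j k l : cint_ok (fun psi =>
  conjC (amp psi i) * amp psi j * amp psi k * conjC (amp psi l)).
Proof.
apply: cint_okM; last by apply: cint_okJ; exact: amp_ok.
apply: cint_okM; last exact: amp_ok.
by apply: cint_okM; [apply: cint_okJ|]; exact: amp_ok.
Qed.

Lemma moment_swap i j k l : moment i j k l = moment i k j l.
Proof. by congr cint; apply/funext => psi; ring. Qed.

Lemma cI_conj : (conjC 'i * 'i)%C = 1 :> R[i].
Proof. by rewrite conjCE; apply/eqP; rewrite eq_complex /=; apply/andP; split; apply/eqP; ring. Qed.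

(** The reflection condition with [s = 1] reads 2 = |1 - i|^2. The matrix is diagonal, with i at
    position [c] and 1 elsewhere. *)
Lemma phase_unitary (c : 'I_d) (e := delta_mx c 0 : 'cV[R[i]]_d) :
  1%:M - (1 - 'i%C) *: (e *m e^t*) \is unitarymx.
Proof.
apply: (@reflection_unitary _ _ _ 1).
  apply/matrixP => a b; rewrite !ord1 mxE (bigD1 c) //= !mxE !eqxx conjC1 mulr1.
  by rewrite big1 ?addr0 // => k /negbTE nk; rewrite !mxE nk mulr0.
rewrite mul1r rmorphB rmorph1 mulrBl mul1r mulrBr mulr1 [_ * conjC _]mulrC cI_conj.
by ring.
Qed.

Definition phase (c i : 'I_d) : R[i] := if i == c then 'i%C else 1.

Lemma amp_phase c i psi :
  amp (uapp (unitary_of (phase_unitary c)) psi) i = phase c i * amp psi i.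
Proof.
rewrite /= /umx /= mulmxBl mul1mx -scalemxAl -mulmxA !mxE big_ord1 !mxE.
rewrite (bigD1 c) //= big1 ?addr0; last first.
  by move=> k /negbTE nk; rewrite !mxE nk conjC0 mul0r.
rewrite !mxE !eqxx conjC1 mul1r /phase andbT.
by case: (eqVneq i c) => [->|_] /=; rewrite ?mul1r ?mul0r ?mulr0 ?subr0 //; ring.
Qed.

Lemma moment_phase c i j k l : moment i j k l =
  conjC (phase c i) * phase c j * phase c k * conjC (phase c l) * moment i j k l.
Proof.
rewrite -[X in _ = X]cintZ; last exact: moment_ok.
rewrite -[LHS](cint_haar (unitary_of (phase_unitary c))); last exact: moment_ok.
congr cint; apply/funext => psi; rewrite !amp_phase !rmorphM /=; ring.
Qed.

Lemma cI_neq1 : 'i%C != 1 :> R[i].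
Proof. by rewrite eq_complex /= negb_and oner_eq0 orbT. Qed.

(** By Haar invariance a moment is unchanged when multiplied by the phases of its four indices.
    Unless the indices pair up, some phase gate makes this factor different from 1. *)
Lemma moment_eq0 i j k l :
  ~~ ((i == j) && (k == l)) -> ~~ ((i == k) && (j == l)) -> moment i j k l = 0.
Proof.
have z (x : R[i]) y : x = y * x -> y != 1 -> x = 0.
  move=> /eqP; rewrite -subr_eq0 -{1}[x]mul1r -mulrBl mulf_eq0 subr_eq0.
  by case/orP=> /eqP-> //; rewrite eqxx.
have H a b e : b != e -> moment a a b e = 0.
  move=> be; apply: z (moment_phase b a a b e) _.
  have -> : conjC (phase b a) * phase b a = 1.
    by rewrite /phase; case: ifP => _; rewrite ?cI_conj // conjC1 mulr1.
  by rewrite /phase eqxx [e == b]eq_sym (negbTE be) conjC1 mulr1 mul1r cI_neq1.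
have [<- /= kl _|ij _] := eqVneq i j; first exact: H.
have [<- /= jl|ik _] := eqVneq i k; first by rewrite moment_swap; exact: H.
(* The factor is -i, or its square -1 when [l = i]. A gate with sign -1 in place of i would miss the
   latter case. *)
apply: z (moment_phase i i j k l) _.
rewrite /phase eqxx ![_ == i]eq_sym (negbTE ij) (negbTE ik) !mulr1.
case: ifP => _; rewrite ?conjC1 ?mulr1 conjCE /=; last first.
  by rewrite eq_complex /= negb_and oppr_eq0 oner_eq0 orbT.
rewrite eq_complex /= negb_and; apply/orP; left.
by rewrite mulrNN mul0r mulr1 sub0r -subr_eq0 -opprD oppr_eq0 -mulr2n pnatr_eq0.
Qed.

End HaarMoments.

Section MixingIdentity.
Variable R : realType.
Implicit Types z w c : R[i].

Definition sqmod z : R := complex.Re z ^+ 2 + complex.Im z ^+ 2.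

(** Here [m] and [l] are the real and imaginary parts of c w, where c = p + i q and w = x + i y. *)
Lemma mixing_parts (a b p q x y : R) (m := p * x - q * y) (l := p * y + q * x) :
  ((1 + 'i%C) * (a +i* b)%C - (1 - 'i%C) * (p +i* q)%C * (x +i* y)%C) / 2 =
  (((a - b - m - l) / 2) +i* ((a + b - l + m) / 2))%C.
Proof.
apply: (@mulIf _ (2%:R : R[i])); rewrite ?pnatr_eq0 // divfK ?pnatr_eq0 //.
rewrite mulr_natr mulr2n /m /l; apply/eqP; rewrite eq_complex.
by apply/andP; split; apply/eqP => /=; field.
Qed.

(** Since 1 - i = -i (1 + i), [h c] equals |z + i c w|^4 / 4. Over the four values of [c] the cross
    term cancels to first order, while its square raises the coefficient of |z|^2 |w|^2 from 2 to
    4. *)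
Lemma mixing_identity z w
    (h := fun c => sqmod (((1 + 'i%C) * z - (1 - 'i%C) * c * w) / 2) ^+ 2) :
  h 1 + h (-1) + h 'i%C + h (- 'i)%C =
  sqmod z ^+ 2 + sqmod w ^+ 2 + 4 * (sqmod z * sqmod w).
Proof.
rewrite {}/h; case: z w => [a b] [x y].
have e c p q : c = (p +i* q)%C ->
   sqmod (((1 + 'i%C) * (a +i* b)%C - (1 - 'i%C) * c * (x +i* y)%C) / 2) =
   ((a - b - (p * x - q * y) - (p * y + q * x)) / 2) ^+ 2 +
   ((a + b - (p * y + q * x) + (p * x - q * y)) / 2) ^+ 2.
  by move=> ->; rewrite mixing_parts.
rewrite (e 1 1 0) // (e (-1) (-1) 0); last by apply/eqP; rewrite eq_complex /= oppr0 !eqxx.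
rewrite (e 'i%C 0 1) // (e (- 'i)%C 0 (-1)); last by apply/eqP; rewrite eq_complex /= oppr0 !eqxx.
by rewrite /sqmod /=; field.
Qed.

End MixingIdentity.

Section HaarSecondMoments.
Variables (R : realType) (n : nat) (mu : probability (pure_state R n) R).
Hypothesis haar_mu : is_haar_state mu.
Local Notation d := (2 ^ n)%N.
Implicit Types (i j k l : 'I_d) (psi : pure_state R n).
Local Notation amp psi i := (ket psi i 0).

Definition prob_moment i k : R := \int[mu]_psi (prob psi i * prob psi k).

Lemma conj_amp psi i : conjC (amp psi i) * amp psi i = (prob psi i)%:C%C.
Proof. exact: normc_sqrE. Qed.

Lemma moment_fun_prob i k : (fun psi => conjC (amp psi i) * amp psi i *
  amp psi k * conjC (amp psi k)) = (fun psi => (prob psi i * prob psi k)%:C%C).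
Proof.
by apply/funext => psi; rewrite -mulrA [X in _ * X]mulrC !conj_amp -rmorphM.
Qed.

Lemma momentE i k : moment mu i i k k = (prob_moment i k)%:C%C.
Proof.
rewrite /moment moment_fun_prob /cint /=.
by rewrite Rintegral_cst // mul0r.
Qed.

Lemma prob_moment_integrable i k :
  mu.-integrable setT (EFin \o (fun psi => prob psi i * prob psi k)).
Proof.
have := (cint_integrable mu (@moment_ok R n i i k k)).1.
congr (_.-integrable _ _); apply/funext => psi /=; congr EFin.
by have /(congr1 (fun h => complex.Re (h psi))) /= := moment_fun_prob i k.
Qed.

Lemma prob_momentC i k : prob_moment i k = prob_moment k i.
Proof. by apply: eq_Rintegral => psi _; rewrite mulrC. Qed.

(** Here |u|^2 = 2, and c = (1 - i) / 2 satisfies c + conj c = 1 = 2 |c|^2. The resulting unitary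
    multiplies [u] by the imaginary unit and fixes its orthogonal complement. *)
Lemma mixing_unitary (i k : 'I_d) (t : R[i]) : i != k -> conjC t * t = 1 ->
  let u : 'cV[R[i]]_d := delta_mx i 0 + t *: delta_mx k 0 in
  1%:M - ((1 - 'i%C) / 2) *: (u *m u^t*) \is unitarymx.
Proof.
move=> ik tt; set u := delta_mx i 0 + _; apply: (@reflection_unitary _ _ u 2).
  apply/matrixP => a b; rewrite !ord1 mxE (bigD1 i) //= (bigD1 k) 1?eq_sym //=.
  rewrite !mxE !eqxx [k == i]eq_sym (negbTE ik) /= !mulr0 !addr0 !add0r mulr1 conjC1 mulr1.
  rewrite big1 ?addr0 ?tt // => j /andP[/negbTE ji /negbTE jk].
  by rewrite !mxE ji jk /= !mulr0 addr0 mulr0.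
have h : conjC (2^-1 : R[i]) = 2^-1 by rewrite fmorphV rmorph_nat.
rewrite rmorphM /= h rmorphB rmorph1.
have -> : (1 - 'i%C) / 2 * ((1 - conjC 'i%C) / 2) =
  (1 - 'i%C - conjC 'i%C + conjC 'i%C * 'i%C) / 2 / 2 :> R[i] by ring.
rewrite cI_conj; by field.
Qed.

Lemma amp_mixing (i k : 'I_d) (t : R[i]) (ik : i != k) (tt : conjC t * t = 1) psi :
  amp (uapp (unitary_of (mixing_unitary ik tt)) psi) i =
  ((1 + 'i%C) * amp psi i - (1 - 'i%C) * conjC t * amp psi k) / 2.
Proof.
rewrite /= /umx /= mulmxBl mul1mx -scalemxAl -mulmxA !mxE big_ord1 !mxE.
rewrite (bigD1 i) //= (bigD1 k) 1?eq_sym //= big1 ?addr0; last first.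
  move=> j /andP[/negbTE ji /negbTE jk].
  by rewrite !mxE ji jk /= mulr0 addr0 conjC0 mul0r.
rewrite !mxE !eqxx [k == i]eq_sym (negbTE ik) /= !mulr0 !addr0 !add0r mulr1 conjC1.
rewrite ?mulr1 ?mul1r; by field.
Qed.

Lemma integrable_add (g h : pure_state R n -> R) :
  mu.-integrable setT (EFin \o g) -> mu.-integrable setT (EFin \o h) ->
  mu.-integrable setT (EFin \o (fun x => g x + h x)).
Proof.
by move=> ig ih; rewrite (_ : _ \o _ = (EFin \o g) \+ (EFin \o h))%E //; exact: integrableD.
Qed.

Lemma Rintegral_add4 (g1 g2 g3 g4 : pure_state R n -> R) :
  mu.-integrable setT (EFin \o g1) -> mu.-integrable setT (EFin \o g2) ->
  mu.-integrable setT (EFin \o g3) -> mu.-integrable setT (EFin \o g4) ->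
  \int[mu]_x (g1 x + g2 x + g3 x + g4 x) =
  \int[mu]_x g1 x + \int[mu]_x g2 x + \int[mu]_x g3 x + \int[mu]_x g4 x.
Proof.
move=> i1 i2 i3 i4; have i12 := integrable_add i1 i2.
rewrite (RintegralD _ (integrable_add i12 i3) i4) //.
by rewrite (RintegralD _ i12 i3) // (RintegralD _ i1 i2).
Qed.

(* The mixing unitary turns the i-th amplitude into (psi_i + z psi_k) / sqrt 2 up
   to a phase, where |z| = 1; averaging the fourth power of its modulus over the
   four values z ^ 4 = 1 cancels the cross terms. *)
Lemma prob_moment_mixing (i k : 'I_d) : i != k ->
  4 * prob_moment i i = prob_moment i i + prob_moment k k + 4 * prob_moment i k.
Proof.
move=> ik.
have t1 : conjC (1 : R[i]) * 1 = 1 by rewrite conjC1 mulr1.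
have t2 : conjC (- 1 : R[i]) * - 1 = 1 by rewrite rmorphN rmorph1 mulrNN mulr1.
have t3 := cI_conj R.
have t4 : conjC (- 'i%C : R[i]) * - 'i%C = 1 by rewrite rmorphN mulrNN cI_conj.
pose f psi := prob psi i * prob psi i.
pose V t (tt : conjC t * t = 1) := unitary_of (mixing_unitary ik tt).
have okV t tt : cint_ok (fun psi : pure_state R n => (f (uapp (@V t tt) psi))%:C%C).
  have -> : (fun psi => (f (uapp (@V t tt) psi))%:C%C) =
      (fun psi => (f psi)%:C%C) \o uapp (@V t tt) by [].
  rewrite /f -moment_fun_prob; exact/cint_ok_uapp/moment_ok.
have iV t tt : mu.-integrable setT (EFin \o (fun psi => f (uapp (@V t tt) psi))).
  exact: (cint_integrable mu (okV t tt)).1.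
have e t tt : \int[mu]_psi f (uapp (@V t tt) psi) = prob_moment i i.
  have mf : measurable_fun setT f.
    by have /integrableP[/measurable_EFinP] := prob_moment_integrable i i.
  exact: (haar_state_integral haar_mu mf (iV t tt)).
have add4 (a b c g a' b' c' g' : R) : a = a' -> b = b' -> c = c' -> g = g' ->
    a + b + c + g = a' + b' + c' + g' by move=> -> -> -> ->.
have K t tt c psi : conjC t = c -> f (uapp (@V t tt) psi) =
    sqmod (((1 + 'i%C) * amp psi i - (1 - 'i%C) * c * amp psi k) / 2) ^+ 2.
  by move=> <-; rewrite /f -expr2 -amp_mixing.
have i4 : mu.-integrable setT (EFin \o (fun psi => 4 * (prob psi i * prob psi k))).
  rewrite (_ : _ \o _ =
    (fun x => 4%:E * (EFin \o (fun psi => (prob psi i * prob psi k)%R)) x)%E) //.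
  by apply: integrableZl => //; exact: prob_moment_integrable.
have [ii kk] := (prob_moment_integrable i i, prob_moment_integrable k k).
have c1 : conjC 1 = 1 :> R[i] by exact: conjC1.
have c2 : conjC (-1) = -1 :> R[i] by rewrite rmorphN rmorph1.
have c3 : conjC 'i%C = - 'i%C :> R[i] by apply/eqP; rewrite eq_complex /= oppr0 !eqxx.
have c4 : conjC (- 'i%C) = 'i%C :> R[i] by apply/eqP; rewrite eq_complex /= !opprK oppr0 !eqxx.
(* [t4] precedes [t3] because [amp_mixing] involves the conjugate of [t]: t = -i produces the term c
   = i of [mixing_identity]. *)
transitivity (\int[mu]_psi (f (uapp (V _ t1) psi) +
    f (uapp (V _ t2) psi) + f (uapp (V _ t4) psi) + f (uapp (V _ t3) psi))).
  rewrite (Rintegral_add4 (iV _ t1) (iV _ t2) (iV _ t4) (iV _ t3)).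
  rewrite (add4 _ _ _ _ _ _ _ _ (e _ t1) (e _ t2) (e _ t4) (e _ t3)).
  by move: (prob_moment i i) => x; ring.
rewrite -(RintegralZl _ measurableT (prob_moment_integrable i k)).
rewrite -(RintegralD measurableT ii kk) -(RintegralD measurableT (integrable_add ii kk) i4).
apply: eq_Rintegral => psi _.
rewrite (add4 _ _ _ _ _ _ _ _ (K _ t1 _ psi c1) (K _ t2 _ psi c2)
  (K _ t4 _ psi c4) (K _ t3 _ psi c3)).
by rewrite mixing_identity -!expr2.
Qed.

End HaarSecondMoments.

Section HaarMomentValues.
Variables (R : realType) (n : nat) (mu : probability (pure_state R n) R).
Hypothesis haar_mu : is_haar_state mu.
Local Notation d := (2 ^ n)%N.
Implicit Types (i j k l : 'I_d) (psi : pure_state R n).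
Local Notation amp psi i := (ket psi i 0).

Lemma cint_cst (c : R[i]) : cint mu (fun=> c) = c.
Proof.
have muT : fine (mu setT) = 1 by rewrite probability_setT.
by case: c => a b; rewrite /cint /= !Rintegral_cst //= muT !mulr1.
Qed.

Lemma sum_prob_moment : \sum_i \sum_k prob_moment mu i k = 1.
Proof.
apply: complexI; rewrite rmorph1 rmorph_sum /= -(cint_cst 1).
transitivity (cint mu (fun psi => \sum_i \sum_k
    conjC (amp psi i) * amp psi i * amp psi k * conjC (amp psi k))).
  rewrite cint_sum; last by move=> i; apply: cint_ok_sum => k; exact: moment_ok.
  apply: eq_bigr => i _; rewrite cint_sum; last by move=> k; exact: moment_ok.
  by rewrite rmorph_sum; apply: eq_bigr => k _; exact/esym/momentE.
congr cint; apply/funext => psi.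
transitivity ((\sum_i (prob psi i)%:C%C) * (\sum_i (prob psi i)%:C%C) : R[i]).
  rewrite mulr_suml; apply: eq_bigr => i _; rewrite mulr_sumr; apply: eq_bigr => k _.
  by rewrite -mulrA [X in _ * X]mulrC !conj_amp.
by rewrite -rmorph_sum sum_prob mulr1.
Qed.

Definition haar_weight : R := (d * d.+1)%:R^-1.

(** The mixing relation for (i, k) and for (k, i) forces equal diagonal moments, with each
    off-diagonal one half of them. The total mass 1 then fixes the common value. *)
Lemma prob_momentE i k : prob_moment mu i k = haar_weight * (1 + (i == k)%:R).
Proof.
have diag j l : j != l -> prob_moment mu j j = prob_moment mu l l /\
    prob_moment mu j l = prob_moment mu j j / 2.
  move=> jl; have h1 := prob_moment_mixing haar_mu jl.
  have lj : l != j by rewrite eq_sym.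
  have h2 := prob_moment_mixing haar_mu lj.
  rewrite (prob_momentC _ l j) in h2; split; lra.
have all j l : prob_moment mu j l = prob_moment mu i i / 2 * (1 + (j == l)%:R).
  have dj : prob_moment mu j j = prob_moment mu i i.
    by have [->//|/diag[]] := eqVneq j i.
  have [<-|jl] := eqVneq j l; first by rewrite dj mulrDr mulr1 -splitr.
  by rewrite addr0 mulr1 -dj; case: (diag _ _ jl).
suff -> : haar_weight = prob_moment mu i i / 2 by [].
have row j : \sum_l prob_moment mu j l = prob_moment mu i i / 2 * d.+1%:R.
  under eq_bigr do rewrite all; rewrite -mulr_sumr big_split /= sumr_const card_ord.
  rewrite (bigD1 j) //= eqxx big1 ?addr0 -?[d.+1%:R]natr1 //.
  by move=> l /negbTE; rewrite eq_sym => ->.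
have := sum_prob_moment; under eq_bigr do rewrite row.
rewrite sumr_const card_ord -mulrnAr -mulrnA mulnC => h.
have d0 : (d * d.+1)%:R != 0 :> R by rewrite pnatr_eq0 muln_eq0 negb_or expn_eq0.
by apply: (mulIf d0); rewrite h mulVf.
Qed.

(** These are the entries of the second moment operator of a Haar state, (identity + swap) / (d (d +
    1)). *)
Lemma moment_haar i j k l : moment mu i j k l =
  haar_weight%:C%C * (((i == j) && (k == l))%:R + ((i == k) && (j == l))%:R).
Proof.
have m a b : moment mu a a b b = haar_weight%:C%C * (1 + (a == b)%:R).
  by rewrite momentE prob_momentE rmorphM rmorphD rmorph1 rmorph_nat.
have [/andP[/eqP<- /eqP<-]|h1] := boolP ((i == j) && (k == l)).
  by rewrite m andbb.
have [/andP[/eqP ik /eqP jl]|h2] := boolP ((i == k) && (j == l)).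
  subst k l; rewrite moment_swap m; suff /negbTE -> : i != j by rewrite addr0 add0r.
  by apply: contra h1 => /eqP->; rewrite eqxx.
by rewrite (moment_eq0 haar_mu) // addr0 mulr0.
Qed.

End HaarMomentValues.

Lemma adjmxZ (R : realType) (m n : nat) (c : R[i]) (A : 'M[R[i]]_(m, n)) :
  (c *: A)^t* = conjC c *: A^t*.
Proof. by apply/matrixP => i j; rewrite !mxE rmorphM. Qed.

Lemma adjmx_sum (R : realType) (m n : nat) (I : Type) (r : seq I)
    (F : I -> 'M[R[i]]_(m, n)) :
  (\sum_(i <- r) F i)^t* = \sum_(i <- r) (F i)^t*.
Proof.
apply/matrixP => i j; rewrite !mxE summxE rmorph_sum summxE.
by apply: eq_bigr => k _; rewrite !mxE.
Qed.

(** * Average fidelity of a channel *)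

Section AverageFidelity.
Variables (R : realType) (n : nat) (mu : probability (pure_state R n) R).
Hypothesis haar_mu : is_haar_state mu.
Local Notation d := (2 ^ n)%N.
Implicit Types (i j k l : 'I_d) (psi : pure_state R n).
Local Notation amp psi i := (ket psi i 0).

(** The fidelity integrand, kept complex and without normalization so that it can be expanded as a
    polynomial in the amplitudes. *)
Definition overlap (E : 'M[R[i]]_d -> 'M[R[i]]_d) (U : 'M[R[i]]_d)
    (psi : 'cV[R[i]]_d) : R[i] :=
  ((U *m psi)^t* *m E (psi *m psi^t*) *m (U *m psi)) 0 0.

Lemma unit_ket psi : (ket psi)^t* *m ket psi = 1%:M.
Proof. exact/eqP/(svalP psi). Qed.

Lemma channel_psd (E : channel R d) (x : 'cV[R[i]]_d) : psdmx (E (x *m x^t*)).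
Proof.
move=> v; have := @cp_sum _ _ E 1 (fun=> x) (fun=> v) (@channel_cp _ _ E).
by rewrite !big_ord1.
Qed.

Lemma fidelity_overlap (E : channel R d) (U : unitary R d) psi :
  fidelity (unitary_map U (density psi)) (E (density psi)) =
  complex.Re (overlap E (umx U) (ket psi)).
Proof.
rewrite -fidelity_pure; first last.
- exact: channel_psd.
- exact: unit_ket (uapp U psi).
by rewrite /unitary_map /density adjmxM !mulmxA.
Qed.

Lemma overlap_ge0 (E : channel R d) (U : 'M[R[i]]_d) (psi : 'cV[R[i]]_d) :
  0 <= overlap E U psi.
Proof. exact: channel_psd. Qed.

Lemma mulmx_cols (M : 'M[R[i]]_d) (v : 'cV[R[i]]_d) : M *m v = \sum_k v k 0 *: col k M.
Proof.
apply/matrixP => a b; rewrite !mxE summxE; apply: eq_bigr => k _.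
by rewrite !mxE ord1 mulrC.
Qed.

Lemma form_col (W M : 'M[R[i]]_d) i j :
  ((col i W)^t* *m M *m col j W) 0 0 = (W^t* *m M *m W) i j.
Proof.
rewrite !mxE; apply: eq_bigr => k _; rewrite !mxE; congr (_ * _).
by apply: eq_bigr => l _; rewrite !mxE.
Qed.

(* The Choi matrix of E, in the basis of the columns of Q on the input side and
   of the columns of W on the output side. *)
Definition choi (E : 'M[R[i]]_d -> 'M[R[i]]_d) (W Q : 'M[R[i]]_d) i j k l : R[i] :=
  ((col i W)^t* *m E (col k Q *m (col l Q)^t*) *m col j W) 0 0.

Lemma form_expand (W M : 'M[R[i]]_d) (v : 'cV[R[i]]_d) :
  ((W *m v)^t* *m M *m (W *m v)) 0 0 =
  \sum_i \sum_j conjC (v i 0) * v j 0 * ((col i W)^t* *m M *m col j W) 0 0.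
Proof.
rewrite adjmxM !mulmxA -[_ *m W^t* *m M]mulmxA -[_ *m (_ *m M) *m W]mulmxA formE.
apply: eq_bigr => i _; apply: eq_bigr => j _.
by rewrite form_col mulrAC.
Qed.

Lemma overlap_expand (E : {linear 'M[R[i]]_d -> 'M[R[i]]_d}) (U Q : 'M[R[i]]_d) psi :
  overlap E U (Q *m ket psi) = \sum_i \sum_j \sum_k \sum_l
    choi E (U *m Q) Q i j k l *
    (conjC (amp psi i) * amp psi j * amp psi k * conjC (amp psi l)).
Proof.
rewrite /overlap mulmxA form_expand; apply: eq_bigr => i _; apply: eq_bigr => j _.
have -> : Q *m ket psi *m (Q *m ket psi)^t* =
    \sum_k \sum_l (amp psi k * conjC (amp psi l)) *: (col k Q *m (col l Q)^t*).
  rewrite mulmx_cols mulmx_suml; apply: eq_bigr => k _.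
  rewrite -scalemxAl adjmx_sum mulmx_sumr scaler_sumr.
  by apply: eq_bigr => l _; rewrite adjmxZ -scalemxAr scalerA.
rewrite linear_sum mulmx_sumr mulmx_suml summxE mulr_sumr; apply: eq_bigr => k _.
rewrite linear_sum mulmx_sumr mulmx_suml summxE mulr_sumr; apply: eq_bigr => l _.
by rewrite linearZ /= -scalemxAr -scalemxAl mxE /choi; ring.
Qed.

(** The sum is the trace, computed in the basis [W], of the image of a rank-one projector under the
    trace preserving [E]. *)
Lemma choi_trace (E : channel R d) (W Q : 'M[R[i]]_d) k :
  W \is unitarymx -> Q \is unitarymx -> \sum_i choi E W Q i i k k = 1.
Proof.
move=> uW uQ; rewrite /choi; under eq_bigr do rewrite form_col.
rewrite -/(mxtrace _) mxtrace_mulC mulmxA (unitarymxP uW) mul1mx channel_tp.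
rewrite mxtrace_mulC /mxtrace big_ord1 -[X in X *m _]mulmx1 form_col mulmx1.
by rewrite (mulmx1C (unitarymxP uQ)) mxE eqxx.
Qed.

(** For W = U Q with [Q] unitary this is d^2 times the entanglement fidelity of [E] with [U]. *)
Definition choi_sum (E : 'M[R[i]]_d -> 'M[R[i]]_d) (W Q : 'M[R[i]]_d) : R[i] :=
  \sum_i \sum_j choi E W Q i j i j.

Lemma overlap_ok (E : {linear 'M[R[i]]_d -> 'M[R[i]]_d}) (U Q : 'M[R[i]]_d) :
  cint_ok (fun psi => overlap E U (Q *m ket psi)).
Proof.
under eq_fun do rewrite overlap_expand.
do 4 (apply: cint_ok_sum => ?); apply: cint_okM; first exact: cint_ok_cst.
exact: moment_ok.
Qed.

(** Haar invariance allows any orthonormal basis [Q], which later is adapted to the queried states.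
    Of the two pairings in [moment_haar], one adds up [d] unit traces and the other gives
    [choi_sum]. *)
Lemma d_avg_choi (E : channel R d) (U Q : unitary R d) :
  1 - d_avg mu (unitary_map U) E = haar_weight R n *
    (d%:R + complex.Re (choi_sum E (umx U *m umx Q) (umx Q))).
Proof.
have uW := svalP (umul U Q); have uQ := svalP Q.
rewrite /d_avg subKr; under eq_Rintegral do rewrite fidelity_overlap.
have ok1 : cint_ok (fun psi => overlap E (umx U) (ket psi)).
  by have := overlap_ok E (umx U) 1%:M; under eq_fun do rewrite mul1mx.
transitivity (complex.Re (cint mu (fun psi => overlap E (umx U) (umx Q *m ket psi)))).
  by rewrite (cint_haar haar_mu Q ok1).
under [X in cint mu X]eq_fun do rewrite overlap_expand.
have okM i j k l : cint_ok (fun psi => choi E (umx U *m umx Q) (umx Q) i j k l *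
    (conjC (amp psi i) * amp psi j * amp psi k * conjC (amp psi l))).
  by apply: cint_okM; [exact: cint_ok_cst | exact: moment_ok].
set T := choi E _ _.
have -> : cint mu (fun psi => \sum_i \sum_j \sum_k \sum_l T i j k l *
    (conjC (amp psi i) * amp psi j * amp psi k * conjC (amp psi l))) =
    \sum_i \sum_j \sum_k \sum_l T i j k l * moment mu i j k l.
  rewrite cint_sum; last by move=> i; do 3 (apply: cint_ok_sum => ?).
  apply: eq_bigr => i _; rewrite cint_sum; last by move=> j; do 2 (apply: cint_ok_sum => ?).
  apply: eq_bigr => j _; rewrite cint_sum; last by move=> k; do 1 (apply: cint_ok_sum => ?).
  apply: eq_bigr => k _; rewrite cint_sum; last by move=> l.
  by apply: eq_bigr => l _; rewrite cintZ //; exact: moment_ok.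
have -> : \sum_i \sum_j \sum_k \sum_l T i j k l * moment mu i j k l =
    (haar_weight R n)%:C%C * (d%:R + choi_sum E (umx U *m umx Q) (umx Q)).
  (* The first sum collects the terms with i = j and k = l, the second those with i = k and j =
     l. *)
  transitivity (\sum_i \sum_k T i i k k * (haar_weight R n)%:C%C +
      \sum_i \sum_j T i j i j * (haar_weight R n)%:C%C).
    rewrite -big_split /=; apply: eq_bigr => i _.
    under eq_bigr do under eq_bigr do under eq_bigr do
      rewrite (moment_haar haar_mu) mulrDr mulrDr.
    under eq_bigr do under eq_bigr do rewrite big_split /=.
    under eq_bigr do rewrite big_split /=.
    rewrite big_split /=; congr (_ + _).
      rewrite (bigD1 i) //= [X in _ + X]big1 ?addr0; last first.
        move=> j /negbTE ji; rewrite big1 // => k _; rewrite big1 // => l _.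
        by rewrite eq_sym ji /= !mulr0.
      apply: eq_bigr => k _; rewrite (bigD1 k) //= [X in _ + X]big1 ?addr0; last first.
        by move=> l /negbTE lk; rewrite [k == l]eq_sym lk andbF !mulr0.
      by rewrite !eqxx mulr1.
    apply: eq_bigr => j _; rewrite (bigD1 i) //= [X in _ + X]big1 ?addr0; last first.
      move=> k /negbTE ki; rewrite big1 // => l _; by rewrite eq_sym ki /= !mulr0.
    rewrite (bigD1 j) //= [X in _ + X]big1 ?addr0; last first.
      by move=> l /negbTE lj; rewrite [j == l]eq_sym lj andbF !mulr0.
    by rewrite !eqxx mulr1.
  rewrite exchange_big /= mulrDr mulr_sumr; congr (_ + _).
    under eq_bigr do rewrite -mulr_suml (choi_trace E _ uW uQ) mul1r.
    by rewrite sumr_const card_ord mulr_natr.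
  by apply: eq_bigr => i _; rewrite mulr_sumr; apply: eq_bigr => j _; rewrite mulrC.
by rewrite Re_mul /= mul0r subr0 Re_add -[d%:R in LHS](rmorph_nat (real_complex R)).
Qed.

End AverageFidelity.

(** * Averaging over signed permutations *)

Section Twirl.
Variables (R : realType) (n : nat) (mu : probability (pure_state R n) R).
Hypothesis haar_mu : is_haar_state mu.
Local Notation d := (2 ^ n)%N.
Implicit Types (i j k l : 'I_d) (s : {perm 'I_d}) (b : {ffun 'I_d -> bool}).
Implicit Types (E : channel R d).

Lemma choi_diag_ge0 E (W Q : 'M[R[i]]_d) i k : 0 <= choi E W Q i i k k.
Proof. exact: channel_psd. Qed.

Lemma choi_diag_le1 E (W Q : 'M[R[i]]_d) i :
  W \is unitarymx -> Q \is unitarymx -> complex.Re (choi E W Q i i i i) <= 1.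
Proof.
move=> uW uQ; have /(congr1 (@complex.Re R)) := choi_trace E i uW uQ.
rewrite Re_sum (bigD1 i) //= => <-; rewrite lerDl.
by apply: sumr_ge0 => k _; apply: Re_ge0; exact: choi_diag_ge0.
Qed.

(** Complete positivity with two blocks: the inputs are columns [i] and [j] of [Q], tested on column
    [i] of [W] and minus column [j]. The minus sign turns positivity into an upper bound on the
    off-diagonal terms. *)
Lemma choi_offdiag E (W Q : 'M[R[i]]_d) i j :
  complex.Re (choi E W Q i j i j) + complex.Re (choi E W Q j i j i) <=
  complex.Re (choi E W Q i i i i) + complex.Re (choi E W Q j j j j).
Proof.
have pick2 (u v : 'cV[R[i]]_d) :
    exists x : 'I_2 -> 'cV[R[i]]_d, x ord0 = u /\ x (lift ord0 ord0) = v.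
  by exists (fun a => if a == ord0 then u else v).
have [x [x0 x1]] := pick2 (col i Q) (col j Q).
have [y [y0 y1]] := pick2 (col i W) (- col j W).
have formNr (u v : 'cV[R[i]]_d) (M : 'M[R[i]]_d) :
  (u^t* *m M *m (- v)) 0 0 = - (u^t* *m M *m v) 0 0 by rewrite mulmxN mxE.
have formNl (u v : 'cV[R[i]]_d) (M : 'M[R[i]]_d) :
    ((- u)^t* *m M *m v) 0 0 = - (u^t* *m M *m v) 0 0.
  rewrite (_ : (- u)^t* = - u^t*) ?mulNmx ?mxE //.
  by apply/matrixP => a c; rewrite !mxE rmorphN.
have sum2 (f : 'I_2 -> 'I_2 -> R[i]) : \sum_a \sum_b f a b =
    f ord0 ord0 + f ord0 (lift ord0 ord0) + f (lift ord0 ord0) ord0 +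
    f (lift ord0 ord0) (lift ord0 ord0).
  by rewrite !big_ord_recl !big_ord0 !addr0 addrA.
pose f a c := ((y a)^t* *m E (x a *m (x c)^t*) *m y c) 0 0.
have f00 : f ord0 ord0 = choi E W Q i i i i by rewrite /f x0 y0.
have f01 : f ord0 (lift ord0 ord0) = - choi E W Q i j i j.
  by rewrite /f x0 x1 y0 y1 formNr.
have f10 : f (lift ord0 ord0) ord0 = - choi E W Q j i j i.
  by rewrite /f x0 x1 y0 y1 formNl.
have f11 : f (lift ord0 ord0) (lift ord0 ord0) = choi E W Q j j j j.
  by rewrite /f x1 y1 formNr formNl opprK.
have := @cp_sum _ _ E 2 x y (@channel_cp _ _ E).
rewrite (sum2 f) f00 f01 f10 f11.
move: (choi E W Q i i i i) (choi E W Q i j i j) (choi E W Q j i j i) (choi E W Q j j j j).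
by move=> [a ?] [c ?] [e ?] [g ?] /Re_ge0 /=; lra.
Qed.

Definition signed_perm s b : 'M[R[i]]_d :=
  \matrix_(a, j) ((-1) ^+ b j * (a == s j)%:R).

Lemma signed_perm_unitary s b : signed_perm s b \is unitarymx.
Proof.
apply/unitarymxP/mulmx1C/matrixP => j k; rewrite !mxE (bigD1 (s j)) //= big1 ?addr0.
  rewrite !mxE eqxx mulr1 (inj_eq perm_inj) rmorph_sign.
  have [->|] := eqVneq j k; first by rewrite mulr1 -signr_addb addbb.
  by rewrite !mulr0.
by move=> a /negbTE na; rewrite !mxE na mulr0 conjC0 mul0r.
Qed.

Lemma col_signed_perm (W : 'M[R[i]]_d) s b j :
  col j (W *m signed_perm s b) = (-1) ^+ b j *: col (s j) W.
Proof.
apply/matrixP => a c; rewrite !mxE (bigD1 (s j)) //= big1 ?addr0.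
  by rewrite !mxE eqxx mulr1 mulrC.
by move=> k /negbTE nk; rewrite !mxE nk !mulr0.
Qed.

Lemma conj_unitary (Q : unitary R d) (D : 'M[R[i]]_d) : D \is unitarymx ->
  umx Q *m D *m (umx Q)^t* \is unitarymx.
Proof.
move=> uD; have uQ : (umx Q)^t* \is unitarymx by rewrite trmxC_unitary; exact: (svalP Q).
exact: (mul_unitarymx (mul_unitarymx (svalP Q) uD) uQ).
Qed.

Definition twirl (Q : unitary R d) s b : unitary R d :=
  unitary_of (conj_unitary Q (signed_perm_unitary s b)).

(** The twirl acts on the output basis only: the columns of U Q are permuted and signed, while the
    input basis [Q] stays. *)
Lemma choi_sum_twirl E (U Q : unitary R d) s b :
  complex.Re (choi_sum E (umx (umul U (twirl Q s b)) *m umx Q) (umx Q)) =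
  \sum_i \sum_j (-1) ^+ (b i (+) b j) *
    complex.Re (choi E (umx U *m umx Q) (umx Q) (s i) (s j) i j).
Proof.
have -> : umx (umul U (twirl Q s b)) *m umx Q =
    umx U *m umx Q *m signed_perm s b.
  rewrite /umul /twirl /umx /= -!mulmxA; congr (_ *m (_ *m _)).
  by rewrite (mulmx1C (unitarymxP (svalP Q))) mulmx1.
rewrite /choi_sum Re_sum; apply: eq_bigr => i _; rewrite Re_sum; apply: eq_bigr => j _.
rewrite /choi !col_signed_perm adjmxZ rmorph_sign -!scalemxAl -scalemxAr scalerA.
rewrite mxE -signr_addb; case: (b i (+) b j); last by rewrite !mul1r.
by rewrite expr1 !mulN1r; case: (X in - X).
Qed.

Lemma twirl_fix (Q : unitary R d) s b (v : 'cV[R[i]]_d) :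
  signed_perm s b *m ((umx Q)^t* *m v) = (umx Q)^t* *m v ->
  umx (twirl Q s b) *m v = v.
Proof.
move=> h; rewrite /umx /= -!mulmxA h mulmxA (unitarymxP (svalP Q)) mul1mx //.
Qed.

(** With the identity permutation, the twirl by these signs fixes the first [q] columns of [Q]. *)
Definition tail_signs (q : nat) b : {ffun 'I_d -> bool} :=
  [ffun k : 'I_d => (q <= k)%N && b k].

(** Orthogonality of characters: if [i] and [j] differ and one of them is at least [q], flipping the
    sign at that index is an involution that negates every summand. *)
Lemma sum_signs (q : nat) i j :
  \sum_b (-1) ^+ (tail_signs q b i (+) tail_signs q b j) =
  #|{ffun 'I_d -> bool}|%:R * ((i == j) || (i < q)%N && (j < q)%N)%:R :> R.
Proof.
have [<-|ij] := eqVneq i j.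
  by under eq_bigr do rewrite addbb; rewrite sumr_const mulr1.
have [/andP[iq jq]|] := boolP ((i < q)%N && (j < q)%N).
  have [qi qj] : (q <= i)%N = false /\ (q <= j)%N = false by rewrite !(leqNgt q) iq jq.
  under eq_bigr do rewrite !ffunE qi qj; by rewrite sumr_const mulr1.
rewrite /= mulr0 negb_and -!leqNgt.
have flip_sum k (F : {ffun 'I_d -> bool} -> R) :
    (forall b, F [ffun l : 'I_d => b l (+) (l == k)] = - F b) -> \sum_b F b = 0.
  move=> FN; have invk : involutive (fun b => [ffun l : 'I_d => b l (+) (l == k)]).
    by move=> b; apply/ffunP => l; rewrite !ffunE -addbA addbb addbF.
  have : \sum_b F b = - \sum_b F b.
    by rewrite {1}(reindex_inj (inv_inj invk)) /= -sumrN; apply: eq_bigr.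
  lra.
case/orP=> qk; [apply: (flip_sum i) | apply: (flip_sum j)] => b;
  rewrite !ffunE eqxx qk /= ?[j == i]eq_sym (negbTE ij) addbF;
  case: (_ && _); case: (b _); rewrite /= ?expr0 ?expr1 ?opprK //.
Qed.

End Twirl.

Lemma sum_ltn (m q : nat) : (\sum_(j < m) (j < q))%N = minn m q.
Proof.
elim: m => [|m IH]; first by rewrite big_ord0 min0n.
by rewrite big_ord_recr IH /=; case: ltnP => mq; lia.
Qed.

Section TwirlBounds.
Variables (R : realType) (n : nat) (mu : probability (pure_state R n) R).
Hypothesis haar_mu : is_haar_state mu.
Local Notation d := (2 ^ n)%N.
Implicit Types (i j k l : 'I_d) (s : {perm 'I_d}) (b : {ffun 'I_d -> bool}).
Implicit Types (E : channel R d) (U Q : unitary R d).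

(** Composing with a transposition shows that the left side does not depend on [i]. Summed over all
    [i], each permutation merely reindexes the sum of [f]. *)
Lemma sum_perm (f : 'I_d -> R) i :
  \sum_(s : {perm 'I_d}) f (s i) = #|{perm 'I_d}|%:R / d%:R * \sum_k f k.
Proof.
have indep j : \sum_(s : {perm 'I_d}) f (s j) = \sum_(s : {perm 'I_d}) f (s i).
  rewrite (reindex_inj (mulgI (tperm i j))) /=.
  by apply: eq_bigr => s _; rewrite permM tpermR.
have d0 : d%:R != 0 :> R by rewrite pnatr_eq0 expn_eq0.
apply: (mulfI d0); rewrite [RHS]mulrA [d%:R * (_ / _)]mulrC divfK //.
transitivity (\sum_j \sum_(s : {perm 'I_d}) f (s j)).
  by under [RHS]eq_bigr do rewrite indep; rewrite sumr_const card_ord mulr_natl.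
have shuffle (s : {perm 'I_d}) : \sum_j f (s j) = \sum_k f k.
  by rewrite [RHS](reindex_inj (@perm_inj _ s)).
by rewrite exchange_big /=; under eq_bigr do rewrite shuffle; rewrite sumr_const mulr_natl.
Qed.

Lemma sum_signs_form (q : nat) (c : 'I_d -> 'I_d -> R) :
  \sum_(b : {ffun 'I_d -> bool}) \sum_(i < d) \sum_(j < d)
    (-1) ^+ (tail_signs q b i (+) tail_signs q b j) * c i j =
  #|{ffun 'I_d -> bool}|%:R *
    \sum_(i < d) \sum_(j < d) ((i == j) || (i < q)%N && (j < q)%N)%:R * c i j.
Proof.
rewrite exchange_big mulr_sumr; apply: eq_bigr => i _.
rewrite exchange_big mulr_sumr; apply: eq_bigr => j _.
by rewrite -mulr_suml sum_signs mulrA.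
Qed.

Lemma haar_weight_gt0 : 0 < haar_weight R n.
Proof. by rewrite invr_gt0 ltr0n muln_gt0 expn_gt0. Qed.

Lemma tail_signs0 : @tail_signs n 0 = id.
Proof. by apply/funext => b; apply/ffunP => k; rewrite ffunE. Qed.

(** Signs remove the off-diagonal terms, and permutations average each diagonal term to 1 / d by
    [choi_trace]. The double sum thus averages to 1, and (d + 1) / (d (d + 1)) = 1 / d. *)
Lemma twirl_sum_full E U Q :
  \sum_(s : {perm 'I_d}) \sum_(b : {ffun 'I_d -> bool})
    (1 - d_avg mu (unitary_map (umul U (twirl Q s b))) E) =
  #|{perm 'I_d}|%:R * #|{ffun 'I_d -> bool}|%:R / d%:R.
Proof.
have uW := svalP (umul U Q); have uQ := svalP Q.
set N := #|{ffun 'I_d -> bool}|%:R; set S := #|{perm 'I_d}|%:R.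
pose c s i j := complex.Re (choi E (umx U *m umx Q) (umx Q) (s i) (s j) i j).
have inner s : \sum_(b : {ffun 'I_d -> bool})
      (1 - d_avg mu (unitary_map (umul U (twirl Q s b))) E) =
    haar_weight R n * N * (d%:R + \sum_i c s i i).
  under eq_bigr => b _ do rewrite (d_avg_choi haar_mu _ _ Q) choi_sum_twirl.
  rewrite -mulr_sumr big_split /= sumr_const -mulrA; congr (_ * _).
  rewrite mulrDr; congr (_ + _); first by rewrite mulr_natl.
  have := sum_signs_form 0 (c s); rewrite tail_signs0 => ->; congr (_ * _); apply: eq_bigr => i _.
  rewrite (bigD1 i) //= eqxx mul1r big1 ?addr0 // => j /negbTE ji.
  by rewrite eq_sym ji mul0r.
under eq_bigr do rewrite inner.
rewrite -mulr_sumr big_split /= sumr_const exchange_big /=.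
have -> : \sum_i \sum_(s : {perm 'I_d}) c s i i = S.
  transitivity (\sum_(i < d) S / d%:R).
    apply: eq_bigr => i _; rewrite /c.
    rewrite (sum_perm (fun k => complex.Re (choi E (umx U *m umx Q) (umx Q) k k i i))).
    rewrite -Re_sum (choi_trace E i uW uQ) -/S.
    by rewrite mulr1.
  by rewrite sumr_const card_ord -[LHS]mulr_natr divfK // pnatr_eq0 expn_eq0.
rewrite /haar_weight natrM -[_ *+ #|_|]mulr_natl -/S.
have d0 : d%:R != 0 :> R by rewrite pnatr_eq0 expn_eq0.
have d1 : d.+1%:R != 0 :> R by rewrite pnatr_eq0.
have -> : S * d%:R + S = S * d.+1%:R by rewrite -natr1 mulrDr mulr1.
move: (d%:R : R) (d.+1%:R : R) d0 d1 => x y x0 y0.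
by field; rewrite x0 y0.
Qed.

(** After averaging, the weight is 1 on the diagonal and on the leading [q] by [q] block, and 0
    elsewhere. [choi_offdiag] moves the off-diagonal mass onto the diagonal, whose entries are at
    most 1, and each row carries weight at most [q]. *)
Lemma twirl_sum_tail (q : nat) E U Q : (0 < q)%N ->
  \sum_(b : {ffun 'I_d -> bool})
    (1 - d_avg mu (unitary_map (umul U (twirl Q 1%g (tail_signs q b)))) E) <=
  #|{ffun 'I_d -> bool}|%:R * (q.+1%:R / d%:R).
Proof.
move=> q0; have uW := svalP (umul U Q); have uQ := svalP Q.
set N := #|{ffun 'I_d -> bool}|%:R.
pose c i j := complex.Re (choi E (umx U *m umx Q) (umx Q) i j i j).
have -> : \sum_(b : {ffun 'I_d -> bool})
      (1 - d_avg mu (unitary_map (umul U (twirl Q 1%g (tail_signs q b)))) E) =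
    N * (haar_weight R n * (d%:R + \sum_(i < d) \sum_(j < d)
      ((i == j) || (i < q)%N && (j < q)%N)%:R * c i j)).
  under eq_bigr => b _ do rewrite (d_avg_choi haar_mu _ _ Q) choi_sum_twirl.
  rewrite -mulr_sumr big_split /= sumr_const [RHS]mulrCA; congr (_ * _).
  rewrite mulrDr; congr (_ + _); first by rewrite mulr_natl.
  rewrite -sum_signs_form; apply: eq_bigr => b _; apply: eq_bigr => i _; apply: eq_bigr => j _.
  by rewrite !perm1.
have cii0 i : 0 <= c i i by apply: Re_ge0; exact: choi_diag_ge0.
have cii1 i : c i i <= 1 by exact: (choi_diag_le1 E i uW uQ).
have bound : \sum_(i < d) \sum_(j < d) ((i == j) || (i < q)%N && (j < q)%N)%:R * c i j <=
    q%:R * \sum_i c i i.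
  pose w i j : R := ((i == j) || (i < q)%N && (j < q)%N)%:R.
  have wC i j : w i j = w j i by rewrite /w eq_sym andbC.
  (* Rows below [q] have weight min(d, q). Each other row has weight exactly 1, which is at most [q]
     because [q] is positive. *)
  have row i : \sum_j w i j <= q%:R.
    rewrite -natr_sum ler_nat; have [iq|iq] := ltnP i q.
      apply: leq_trans (geq_minr d q); rewrite -sum_ltn; apply: leq_sum => j _.
      by have [<-|_] := eqVneq i j; rewrite /= ?iq.
    rewrite (bigD1 i) //= eqxx big1 ?addn0 // => j /negbTE ji.
    by rewrite eq_sym ji.
  (* The sums are doubled because [choi_offdiag] bounds only the symmetric combination c i j + c j
     i. *)
  have sym : \sum_(i < d) \sum_(j < d) w i j * c i j + \sum_(i < d) \sum_(j < d) w i j * c i j <=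
      \sum_(i < d) \sum_(j < d) w i j * c i i + \sum_(i < d) \sum_(j < d) w i j * c i i.
    have -> : \sum_(i < d) \sum_(j < d) w i j * c i j + \sum_(i < d) \sum_(j < d) w i j * c i j =
        \sum_(i < d) \sum_(j < d) w i j * (c i j + c j i).
      rewrite [X in _ + X]exchange_big -big_split; apply: eq_bigr => i _ /=.
      by rewrite -big_split; apply: eq_bigr => j _ /=; rewrite (wC j i) mulrDr.
    have -> : \sum_(i < d) \sum_(j < d) w i j * c i i + \sum_(i < d) \sum_(j < d) w i j * c i i =
        \sum_(i < d) \sum_(j < d) w i j * (c i i + c j j).
      rewrite [X in _ + X]exchange_big -big_split; apply: eq_bigr => i _ /=.
      by rewrite -big_split; apply: eq_bigr => j _ /=; rewrite (wC j i) mulrDr.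
    apply: ler_sum => i _; apply: ler_sum => j _; rewrite ler_wpM2l ?ler0n //.
    exact: choi_offdiag.
  suff : \sum_(i < d) \sum_(j < d) w i j * c i i <= q%:R * \sum_i c i i.
    move: sym; rewrite -!mulr2n lerMn2r /= => h; exact: le_trans.
  rewrite mulr_sumr; apply: ler_sum => i _; rewrite -mulr_suml.
  by rewrite ler_wpM2r.
have d0 : 0 < d%:R :> R by rewrite ltr0n expn_gt0.
have sc : \sum_i c i i <= d%:R.
  rewrite -[X in _ <= X%:R](card_ord d) -sumr_const; exact: ler_sum.
have tot : d%:R + \sum_(i < d) \sum_(j < d) ((i == j) || (i < q)%N && (j < q)%N)%:R * c i j <=
    q.+1%:R * d%:R.
  rewrite -natr1 mulrDl mul1r addrC lerD2r (le_trans bound) //.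
  by rewrite ler_wpM2l ?ler0n.
have dp : (0 < d)%N by rewrite expn_gt0.
rewrite ler_wpM2l ?ler0n // (le_trans (ler_wpM2l (ltW haar_weight_gt0) tot)) //.
(* The bound reached is (q + 1) / (d + 1); it is weakened to (q + 1) / d, which also covers the case
   q = 0. *)
rewrite /haar_weight natrM invfM mulrCA ler_wpM2l ?ler0n //.
rewrite mulrAC mulVf ?gt_eqF // mul1r lef_pV2 ?posrE ?ltr0n //.
by rewrite ler_nat.
Qed.

End TwirlBounds.

(** * Finite averaging families that fix the queried states *)

Section TwirlFamily.
Variables (R : realType) (n : nat).
Local Notation d := (2 ^ n)%N.

(** Gram-Schmidt on the states, written as the first rows of [A] and padded with the default state
    [point]. The orthonormal rows obtained become the columns of [Q]. *)
Lemma adapted_basis (q : nat) (S : seq (pure_state R n)) :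
  (size S <= q < d)%N -> exists Q : unitary R d, forall psi, psi \in S ->
  forall a : 'I_d, (q <= a)%N -> ((umx Q)^t* *m ket psi) a 0 = 0.
Proof.
move=> /andP[Sq qd].
pose A : 'M[R[i]]_d := \matrix_(j, k) ket (nth point S j) k 0.
pose P := schmidt A; have uP : P \is unitarymx by exact: schmidt_unitarymx.
have uQ : P^T \is unitarymx by rewrite trmx_unitary.
exists (unitary_of uQ) => psi psiS a qa.
have jd : (index psi S < d)%N.
  by rewrite (leq_ltn_trans _ qd) // (leq_trans _ Sq) // ltnW // index_mem.
pose j := Ordinal jd.
have ja : (j < a)%N by rewrite /= (leq_trans _ qa) // (leq_trans _ Sq) // index_mem.
have Aj k : A j k = ket psi k 0 by rewrite mxE /= nth_index.
(* Row [j] of [A] lies in the span of the rows of [P] up to [j], all of them orthogonal to row [a]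
   since j < q <= a. *)
have : (row j A <= kermx (col a (P^t*)))%MS.
  apply: submx_trans (row_schmidt_sub A j) _; apply/sumsmx_subP => k kj.
  rewrite genmxE; apply/sub_kermxP/matrixP => x y; rewrite !ord1.
  have := unitarymxP uP => /matrixP /(_ k a); rewrite !mxE.
  have -> : (k == a) = false by apply/negbTE; rewrite neq_ltn (leq_ltn_trans kj ja).
  move=> e; transitivity (false%:R : R[i]) => //; rewrite -e.
  by apply: eq_bigr => l _; rewrite !mxE.
move=> /sub_kermxP /matrixP /(_ 0 0); rewrite mxE [RHS]mxE => e; rewrite mxE -[RHS]e.
by apply: eq_bigr => k _; rewrite -Aj !mxE mulrC.
Qed.

(** For q = 0 no state has to be fixed, so permutations are available. They are used there because
    signs alone leave a diagonal sum that is only known to be at most [d]. *)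
Lemma twirl_family (mu : probability (pure_state R n) R) (q : nat)
    (S : seq (pure_state R n)) : is_haar_state mu -> (size S <= q < d)%N ->
  exists (I : finType) (W : I -> unitary R d), [/\ (0 < #|I|)%N,
    forall w psi, psi \in S -> uapp (W w) psi = psi &
    forall (E : channel R d) (U : unitary R d),
      \sum_w (1 - d_avg mu (unitary_map (umul U (W w))) E) <=
      #|I|%:R * (q.+1%:R / d%:R)].
Proof.
move=> haar_mu Sq; have [Q QS] := adapted_basis Sq.
have fixS (W : unitary R d) psi : umx W *m ket psi = ket psi -> uapp W psi = psi.
  by move=> h; apply: val_inj.
case: q Sq QS => [|q] Sq QS.
  exists ({perm 'I_d} * {ffun 'I_d -> bool})%type, (fun w => twirl Q w.1 w.2); split.
  - by apply/card_gt0P; exists (1%g, [ffun=> true]).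
  - by move=> w psi; case: S Sq {QS} => [|? ?] //; rewrite ltn0.
  - move=> E U; rewrite -(pair_bigA _
      (fun s b => 1 - d_avg mu (unitary_map (umul U (twirl Q s b))) E)) /=.
    by rewrite (twirl_sum_full haar_mu) card_prod natrM div1r.
exists {ffun 'I_d -> bool}, (fun b => twirl Q 1%g (tail_signs q.+1 b)); split.
- by apply/card_gt0P; exists [ffun=> true].
- move=> b psi psiS; apply: fixS; apply: twirl_fix.
  (* A coordinate of Q^* psi is either below [q.+1], where the sign is trivial, or zero by the
     choice of [Q]. *)
  apply/matrixP => a c; rewrite ord1 {c} mxE (bigD1 a) //= big1 ?addr0.
    rewrite mxE perm1 eqxx mulr1 ffunE; have [qa|_] := leqP q.+1 a; last by rewrite mul1r.
    by rewrite QS // mulr0.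
  by move=> k /negbTE ka; rewrite mxE perm1 eq_sym ka mulr0 mul0r.
- by move=> E U; exact: twirl_sum_tail.
Qed.

End TwirlFamily.

(** * Learners *)

Section LearnerBound.
Variables (R : realType) (n : nat).
Variables (muH : probability (unitary R (2 ^ n)) R) (muS : probability (pure_state R n) R).
Hypotheses (haarH : is_haar_unitary muH) (haarS : is_haar_state muS).
Local Notation d := (2 ^ n)%N.
Implicit Types (U V W : unitary R d) (psi : pure_state R n).

Lemma measurable_umulr V : measurable_fun setT (fun U => umul U V).
Proof.
apply/measurable_umxP; apply: (measurable_mulmx (G := fun=> umx V)).
- exact: measurable_umx.
- exact: measurable_cst.
Qed.

Lemma haar_unitary_integral V (f : unitary R d -> \bar R) :
  measurable_fun setT f -> (forall U, 0 <= f U)%E ->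
  (\int[muH]_U f (umul U V) = \int[muH]_U f U)%E.
Proof.
move=> mf f0; have mV := measurable_umulr V.
rewrite -[RHS](@eq_measure_integral _ _ _ _ _ (pushforward muH (fun U => umul U V))).
- by rewrite ge0_integral_pushforward.
- by move=> A mA _; exact: (haarH V mA).2.
Qed.

(** By [d_avg_choi] in the standard basis, the average fidelity is a polynomial in the entries of
    [U] and their conjugates. *)
Lemma measurable_fidelity (E : channel R d) :
  measurable_fun setT (fun U => 1 - d_avg muS (unitary_map U) E).
Proof.
pose one : unitary R d := unitary_of (one_unitary R d).
under eq_fun do rewrite (d_avg_choi haarS _ _ one).
apply: measurable_funM; first exact: measurable_cst.
apply: measurable_funD; first exact: measurable_cst.
have [] // : cmeas (fun U => choi_sum E (umx U *m umx one) (umx one)).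
do 2 (apply: cmeas_sum => ?); rewrite /choi; under eq_fun do rewrite form_col.
move: (E _) => M; apply: (measurable_mxP _).1.
have mU : measurable_fun setT (fun U => umx U *m umx one).
  by apply: measurable_mulmx; [exact: measurable_umx | exact: measurable_cst].
have mM : measurable_fun setT (fun _ : unitary R d => M) by exact: measurable_cst.
exact: (measurable_mulmx (measurable_mulmx (measurable_adjmx mU) mM) mU).
Qed.

Lemma fidelity_avg_ge0 (E : channel R d) U : 0 <= 1 - d_avg muS (unitary_map U) E.
Proof.
rewrite /d_avg subKr; apply: Rintegral_ge0 => psi _.
by rewrite fidelity_overlap Re_ge0 // overlap_ge0.
Qed.

Lemma success_ge0 (eps : R) U m q (L : learner R n m q) (v : 'cV[R[i]]_m) :
  (0 <= success muS eps U L v)%E.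
Proof.
elim: L v => [m0 q0 E|m0 q0 psi next IH|m0 m1 q0 disp T nu K next IH] v /=.
- by case: ifP => // _; rewrite lee_fin sqnorm_ge0.
- exact: IH.
- by apply: integral_ge0 => t _; exact: IH.
Qed.

Lemma sqnorm_tens m p (v : 'cV[R[i]]_m) (u : 'cV[R[i]]_p) :
  sqnorm (mxtens.tensmx v u : 'cV[R[i]]_(m * p)) = sqnorm v * sqnorm u.
Proof.
apply: complexI; rewrite rmorphM /= -!dot_real mxE sum_mxtens.
rewrite [in RHS]mxE mulr_suml; apply: eq_bigr => a _.
rewrite [X in _ = _ * X]mxE mulr_sumr; apply: eq_bigr => b _.
rewrite !mxE !mxtens.mxtens_indexK /= !ord1 rmorphM.
by ring.
Qed.

(** Expresses that the memory depends on [U] only through the vectors U psi for psi in [S], in a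
    form suited to right invariance of the Haar measure. *)
Definition invariant_under (S : seq (pure_state R n)) m (v : unitary R d -> 'cV[R[i]]_m) :=
  forall U W, (forall psi, psi \in S -> uapp W psi = psi) -> v (umul U W) = v U.

Lemma uapp_umul U W psi : uapp (umul U W) psi = uapp U (uapp W psi).
Proof. by apply: val_inj => /=; rewrite /umx /= mulmxA. Qed.

(** Replacing [U] by U W keeps both the Haar measure and the memory [v], so the success event may be
    averaged over the family [W]. Markov's inequality then compares it with the average fidelity. *)
Lemma output_bound (eps : R) (q m : nat) (S : seq (pure_state R n)) (E : channel R d)
    (v : unitary R d -> 'cV[R[i]]_m) :
  eps < 1 -> (size S <= q < d)%N -> measurable_fun setT v -> invariant_under S v ->
  (\int[muH]_U (if (d_avg muS (unitary_map U) E <= eps)%R then (sqnorm (v U))%:E else 0) <=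
   (q.+1%:R / d%:R / (1 - eps))%:E * \int[muH]_U (sqnorm (v U))%:E)%E.
Proof.
move=> eps1 Sq mv vS.
have [I [W [I0 WS avgW]]] := twirl_family haarS Sq.
set g := fun U => if _ then _ else _.
have ms : measurable_fun setT (fun U => (sqnorm (v U))%:E).
  by apply/measurable_EFinP; exact: measurable_sqnorm.
have mg : measurable_fun setT g.
  apply: measurable_fun_ifT => //.
  have -> : (fun U => d_avg muS (unitary_map U) E <= eps) =
      (fun U => 1 - eps <= 1 - d_avg muS (unitary_map U) E).
    by apply/funext => U; rewrite lerD2l lerN2.
  by apply: measurable_fun_ler; [exact: measurable_cst | exact: measurable_fidelity].
have g0 U : (0 <= g U)%E by rewrite /g; case: ifP => // _; rewrite lee_fin sqnorm_ge0.
have N0 : (0 : R) < #|I|%:R by rewrite ltr0n.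
have e0 : 0 < 1 - eps by rewrite subr_gt0.
have mgW w : measurable_fun setT (fun U => g (umul U (W w))).
  exact: (measurableT_comp mg (measurable_umulr (W w))).
(* Multiplying by the size of the family turns averaging into a plain sum and avoids division in the
   extended reals. *)
rewrite -(@lee_pmul2l _ #|I|%:R%:E) ?lte_fin //.
have -> : (#|I|%:R%:E * \int[muH]_U g U = \int[muH]_U (\sum_w g (umul U (W w))))%E.
  rewrite (ge0_integral_sum muH measurableT mgW (fun w U _ => g0 _)).
  transitivity (\sum_(w : I) \int[muH]_U g U)%E; last first.
    by apply: eq_bigr => w _; rewrite haar_unitary_integral.
  by move: (\int[muH]_U g U)%E => x; rewrite sumr_const mule_natl.
rewrite muleA -EFinM -ge0_integralZl_EFin //; last first.
- by rewrite mulr_ge0 ?ler0n // divr_ge0 ?(ltW e0) // divr_ge0 ?ler0n.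
- by move=> U _; rewrite lee_fin sqnorm_ge0.
apply: ge0_le_integral => //.
- by move=> U _; apply: sume_ge0 => w _.
- exact: emeasurable_sum.
- exact: measurable_funeM.
move=> U _.
(* Markov's inequality pointwise: on the success event the average fidelity is at least 1 - eps. *)
have gle w : (g (umul U (W w)) <=
    ((1 - d_avg muS (unitary_map (umul U (W w))) E) / (1 - eps) * sqnorm (v U))%:E)%E.
  rewrite /g (vS _ _ (WS w)); case: ifP => [h|_]; rewrite lee_fin.
    rewrite -[leLHS]mul1r ler_wpM2r ?sqnorm_ge0 // ler_pdivlMr // mul1r.
    by rewrite lerD2l lerN2.
  by rewrite mulr_ge0 ?sqnorm_ge0 // divr_ge0 ?(ltW e0) // fidelity_avg_ge0.
apply: (le_trans (lee_sum _ (fun w _ => gle w))).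
rewrite sumEFin -EFinM lee_fin -!mulr_suml mulrA ler_wpM2r ?sqnorm_ge0 //.
by rewrite mulrA ler_pM2r ?invr_gt0 // -mulrA.
Qed.

End LearnerBound.

(** * Induction on the protocol *)

Section LearnerInduction.
Variables (R : realType) (n : nat).
Variables (muH : probability (unitary R (2 ^ n)) R) (muS : probability (pure_state R n) R).
Hypotheses (haarH : is_haar_unitary muH) (haarS : is_haar_state muS).
Local Notation d := (2 ^ n)%N.

Lemma sqnorm_ket (psi : pure_state R n) : sqnorm (ket psi) = 1.
Proof. by rewrite /sqnorm unit_ket mxE eqxx. Qed.

(** Generalizes over the current memory [v] and the list [S] of states already queried. Along a
    fixed branch of outcomes these states do not depend on [U], and a query moves one unit from the
    budget [r] to the size of [S]. *)
Lemma learner_bound (eps : R) (q m r : nat) (L : learner R n m r)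
    (S : seq (pure_state R n)) (v : unitary R d -> 'cV[R[i]]_m) :
  eps < 1 -> (size S + r <= q < d)%N -> valid_learner muS L ->
  measurable_fun setT v -> invariant_under S v ->
  (\int[muH]_U success muS eps U L (v U) <=
   (q.+1%:R / d%:R / (1 - eps))%:E * \int[muH]_U (sqnorm (v U))%:E)%E.
Proof.
move=> eps1; have e0 : 0 < 1 - eps by rewrite subr_gt0.
have c0 : 0 <= q.+1%:R / d%:R / (1 - eps) by rewrite divr_ge0 ?(ltW e0) // divr_ge0 ?ler0n.
elim: L S v => [m0 r0 E|m0 r0 psi next IH|m0 m1 r0 disp T nu K next IH] S v.
- move=> /andP[Sq qd] _ mv vS; apply: (output_bound haarH haarS E eps1 _ mv vS).
  by rewrite qd andbT (leq_trans _ Sq) // leq_addr.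
- move=> Sq valid mv vS /=.
  pose v' U : 'cV[R[i]]_(m0 * d) := mxtens.tensmx (v U) (ket (uapp U psi)).
  have mk : measurable_fun setT (fun U => ket (uapp U psi)).
    apply: (measurable_mulmx (F := @umx R d) (G := fun=> ket psi)).
    - exact: measurable_umx.
    - exact: measurable_cst.
  have mv' : measurable_fun setT v' by exact: (measurable_tensmx mv mk).
  (* A unitary [W] fixing psi satisfies U W psi = U psi, so the appended factor is invariant once
     psi joins the list. *)
  have v'S : invariant_under (psi :: S) v'.
    move=> U W WS; rewrite /v' uapp_umul WS ?mem_head // vS // => psi' psiS.
    by apply: WS; rewrite inE psiS orbT.
  have e U : sqnorm (v' U) = sqnorm (v U) by rewrite sqnorm_tens sqnorm_ket mulr1.
  have := IH (psi :: S) v' _ valid mv' v'S.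
  rewrite /= addSnnS => /(_ Sq).
  by under [X in (_ <= _ * X)%E -> _]eq_integral do rewrite e.
- move=> Sq [mK tpK mnext valid] mv vS /=.
  have mF : measurable_fun setT (fun x : T * unitary R d => K x.1 *m v x.2).
    apply: measurable_mulmx.
    - exact: (measurableT_comp mK measurable_fst).
    - exact: (measurableT_comp mv measurable_snd).
  pose f (x : unitary R d * T) := success muS eps x.1 (next x.2) (K x.2 *m v x.1).
  have mswap : measurable_fun setT (fun x : unitary R d * T => (x.2, x.1)).
    by apply: measurable_fun_pair; [exact: measurable_snd | exact: measurable_fst].
  have mf : measurable_fun setT f.
    have mh : measurable_fun setT
        (fun x : unitary R d * T => (x.2, (K x.2 *m v x.1, x.1))).
      apply: measurable_fun_pair; first exact: measurable_snd.
      apply: measurable_fun_pair; last exact: measurable_fst.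
      exact: (measurableT_comp mF mswap).
    exact: (measurableT_comp (mnext eps) mh).
  have f0 x : (0 <= f x)%E by exact: success_ge0.
  pose h (x : unitary R d * T) := (sqnorm (K x.2 *m v x.1))%:E.
  have mh : measurable_fun setT h.
    apply/measurable_EFinP; apply: measurable_sqnorm.
    exact: (measurableT_comp mF mswap).
  have h0 x : (0 <= h x)%E by rewrite lee_fin sqnorm_ge0.
  (* Tonelli puts the outcome outside, where the induction hypothesis applies for each fixed [t].
     Trace preservation [tpK] recovers the norm of [v] from those of the branches. *)
  rewrite (fubini_tonelli f mf f0).
  have -> : (\int[muH]_U (sqnorm (v U))%:E = \int[muH]_U \int[nu]_t h (U, t))%E.
    by apply: eq_integral => U _; rewrite -tpK.
  rewrite (fubini_tonelli h mh h0) -ge0_integralZl_EFin //; last 2 first.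
  - by move=> t _; apply: integral_ge0.
  - exact: (measurable_fun_fubini_tonelli_G h mh h0).
  apply: ge0_le_integral => //.
  - by move=> t _; apply: integral_ge0.
  - exact: (measurable_fun_fubini_tonelli_G f mf f0).
  - apply: measurable_funeM; exact: (measurable_fun_fubini_tonelli_G h mh h0).
  move=> t _; apply: (IH t S (fun U => K t *m v U) Sq (valid t)).
  - by apply: (measurable_mulmx (F := fun=> K t)); [exact: measurable_cst | ].
  - by move=> U W WS; rewrite vS.
Qed.

End LearnerInduction.

Theorem theorem6 (R : realType) (n q : nat) (eps delta : R)
    (muH : probability (unitary R (2 ^ n)) R)
    (muS : probability (pure_state R n) R)
    (L : learner R n 1 q) :
  0 < eps < 1 -> 0 < delta < 1 ->
  is_haar_unitary muH -> is_haar_state muS ->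
  valid_learner muS L ->
  ((1 - delta)%:E <= success_prob muH muS eps L)%E ->
  (2 ^ n)%:R * (1 - delta) * (1 - eps) - 1 <= q%:R.
Proof.
move=> /andP[eps0 eps1] /andP[delta0 delta1] haarH haarS valid succ.
have d0 : 0 < (2 ^ n)%:R :> R by rewrite ltr0n expn_gt0.
(* If q >= 2^n the claim follows from (1 - delta) (1 - eps) <= 1. The averaging argument is run for
   q < 2^n. *)
have [qd|dq] := ltnP q (2 ^ n); last first.
  have le1 : (1 - delta) * (1 - eps) <= 1 by rewrite mulr_ile1 //; lra.
  rewrite lerBlDr -mulrA (le_trans (ler_piMr (ltW d0) le1)) //.
  by rewrite -[1]/(1%:R) -natrD ler_nat (leq_trans dq) ?leq_addr.
have m1 : measurable_fun setT (fun _ : unitary R (2 ^ n) => 1%:M : 'cV[R[i]]_1).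
  exact: measurable_cst.
have Sq : (size (@nil (pure_state R n)) + q <= q < 2 ^ n)%N by rewrite leqnn qd.
(* The initial memory is constant in [U], hence invariant with no state queried yet. *)
have inv1 : @invariant_under _ _ [::] _ (fun _ : unitary R (2 ^ n) => 1%:M : 'cV[R[i]]_1).
  by [].
have := le_trans succ (learner_bound haarH haarS eps1 Sq valid m1 inv1).
have sq1 : sqnorm (1%:M : 'cV[R[i]]_1) = 1.
  by rewrite /sqnorm mulmx1 !mxE eqxx conjC1.
have -> : (\int[muH]_U (sqnorm (1%:M : 'cV[R[i]]_1))%:E = 1)%E.
  by rewrite sq1 integral_cst // mul1e; exact: probability_setT.
rewrite mule1 lee_fin.
rewrite ler_pdivlMr ?subr_gt0 // ler_pdivlMr // => h.
by rewrite lerBlDr natr1 -mulrA mulrC.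
Qed.
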